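(* Let $n\in\mathbb N$. There exists a unique Poisson bracket on $\Psi\mathbf D_q$ of the form $$\{\varphi,\psi\}=\left\langle\left\langle\begin{pmatrix} r+aP_0 & bP_0\\ cP_0 & r+dP_0\end{pmatrix}D\varphi,\;D\psi\right\rangle\right\rangle,\qquad r=\tfrac12(P_+-P_-),$$ where $a,b,c,d$ are linear operators acting in $J_0$ with $a=-a^*$, $d=-d^*$, $c^*=b$, such that 1) the affine subspace $\mathbb M_n$ is a Poisson submanifold; 2) the Hamiltonians $H_m=\frac nm\operatorname{Tr}L^{m/n}$, $m\in\mathbb N$, are in involution and give rise to the Lax equations $$\frac{dL}{dt}=\left[(L^{m/n})_{(+)},L\right],\qquad L\in\mathbb M_n .$$ This bracket is given by $$\{\varphi,\psi\}=\left\langle\left\langle\begin{pmatrix} r+\frac12\frac{1+\hat h^n}{1-\hat h^n}P_0' & -\frac{\hat h^n}{1-\hat h^n}P_0'+\frac12P_{00}\\[4pt] \frac{1}{1-\hat h^n}P_0'+\frac12P_{00} & r-\frac12\frac{1+\hat h^n}{1-\hat h^n}P_0'\end{pmatrix}D\varphi,\;D\psi\right\rangle\right\rangle .$$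
   Context: Fix $q\in\mathbb C$, $0<|q|<1$. $\mathbb C((z^{-1}))$ is the field of formal series $\sum_{i\le N}a_iz^i$; $(\hat hf)(z)=f(qz)$. $\Psi\mathbf D_q$ is the associative algebra of formal series $A=\sum_{i=-\infty}^{N(A)}a_iD^i$, $a_i\in\mathbb C((z^{-1}))$, with $D\cdot a=(\hat ha)\cdot D$. As a linear space $\Psi\mathbf D_q=J_+\oplus J_0\oplus J_-$, where $J_+$ (resp. $J_-$) consists of series with only positive (resp. negative) powers of $D$ and $J_0=\mathbb C((z^{-1}))$; $P_+,P_0,P_-$ are the corresponding projections, $P_{(+)}=P_++P_0$, and $A_{(+)}=P_{(+)}A$, $A_0=P_0A$. For $a=\sum a_iz^i$ put $\int a\,dz/z=a_0$; $\operatorname{Tr}A=\int A_0\,dz/z$ (so $\operatorname{Tr}AB=\operatorname{Tr}BA$); $\langle A,B\rangle=\operatorname{Tr}AB$. Adjoints of operators in $J_0$ are taken with respect to $\langle f,g\rangle=\int fg\,dz/z$. $P_{00}A=\operatorname{Tr}(A)\cdot 1\in J_0$ and $P_0'=P_0-P_{00}$ (so rational expressions such as $\frac{1}{1-\hat h^n}P_0'$ are defined coefficientwise: $\hat h^n z^k=q^{nk}z^k$ and $q^{nk}\ne1$ for $k\neq0$). On $\Psi\mathbf D_q\oplus\Psi\mathbf D_q$ put $\langle\langle (X_1,X_2),(Y_1,Y_2)\rangle\rangle=\langle X_1,Y_1\rangle-\langle X_2,Y_2\rangle$. Functionals: the algebra of observables is generated by the functionals $A\mapsto\operatorname{Tr}(z^{-j}AD^{-i})$.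 A functional $\varphi$ is smooth if for each $L$ it has a linear gradient $d\varphi(L)\in\Psi\mathbf D_q$, $\langle d\varphi(L),X\rangle=\frac{d}{dt}|_{t=0}\varphi(L+tX)$. The left and right gradients are $\nabla\varphi(L)=L\,d\varphi(L)$, $\nabla'\varphi(L)=d\varphi(L)\,L$, and $D\varphi=(\nabla\varphi,\nabla'\varphi)^T$. For functionals defined only on an affine subspace, the gradient is any element representing the derivative along that subspace. $\mathbb M_n\subset\Psi\mathbf D_q$ is the affine subspace of operators $L=D^n+u_{n-1}D^{n-1}+\dots+u_0$, $u_i\in\mathbb C((z^{-1}))$. For $L\in\mathbb M_n$, $L^{1/n}$ denotes the unique element $P=D+\sum_{i\ge0}p_iD^{-i}\in\Psi\mathbf D_q$ with $P^n=L$, and $L^{m/n}=P^m$. One may take $dH_m=L^{m/n-1}$, so that $\nabla H_m=\nabla'H_m=L^{m/n}$. ''$\mathbb M_n$ is a Poisson submanifold'' means that $\{\varphi,\psi\}|_{\mathbb M_n}=0$ for all $\psi$ whenever $\varphi$ is constant on $\mathbb M_n$. The equation generated by a Hamiltonian $H$ is the one for which $\frac{d}{dt}\psi(L)=\{H,\psi\}(L)$ for all $\psi$. *)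

(* Defs.v *)
From HB Require Import structures.
From mathcomp Require Import all_boot all_order all_algebra.
From mathcomp Require Import all_classical all_reals all_analysis.
From mathcomp Require Import complex.

Set Implicit Arguments.
Unset Strict Implicit.
Unset Printing Implicit Defensive.

Import Order.TTheory GRing.Theory Num.Theory.
Import numFieldNormedType.Exports.

Local Open Scope classical_set_scope.
Local Open Scope ring_scope.

(* Formal series [\sum_(i <= N) v_i t^i], as families of coefficients indexed
   by the integers that vanish above some N.  The type is used twice: with
   t = z and complex coefficients for C((z^-1)), and with t = D and
   coefficients in C((z^-1)) for q-pseudodifference operators. *)
Section Series.
Context {K : pzRingType} {V : lmodType K}.
Implicit Types (f g : int -> V).

Definition bounded_above f : Prop :=
  exists N : int, forall i : int, N < i -> f i = 0.

Definition bounded_pred : {pred int -> V} := fun f => `[< bounded_above f >].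

Lemma bounded_predP f : reflect (bounded_above f) (f \in bounded_pred).
Proof. exact: asboolP. Qed.

Fact bounded_submod : submod_closed bounded_pred.
Proof.
split; first by apply/bounded_predP; exists 0.
move=> a f g /bounded_predP[N fN] /bounded_predP[M gM].
apply/bounded_predP; exists (Num.max N M) => i; rewrite gt_max => /andP[Ni Mi].
have -> : (a *: f + g) i = a *: f i + g i by [].
by rewrite fN// gM// scaler0 addr0.
Qed.

HB.instance Definition _ :=
  GRing.isSubmodClosed.Build K (int -> V) bounded_pred bounded_submod.

Record lser := LSer { coef :> int -> V; coef_bounded : coef \in bounded_pred }.

HB.instance Definition _ := [isSub for coef].
HB.instance Definition _ := [Choice of lser by <:].
HB.instance Definition _ := [SubChoice_isSubLmodule of lser by <:].

Definition lser_of f (bf : bounded_above f) : lser :=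
  LSer (introT (bounded_predP f) bf).

Fact mono_bounded (k : int) (v : V) :
  bounded_above (fun i => if i == k then v else 0).
Proof. by exists k => i; case: eqVneq => // ->; rewrite ltxx. Qed.

(* v t^k *)
Definition mono (k : int) (v : V) : lser := lser_of (mono_bounded k v).

Fact trunc_bounded (p : pred int) (A : lser) :
  bounded_above (fun i => if p i then A i else 0).
Proof.
have /bounded_predP[N AN] := coef_bounded A.
by exists N => i /AN ->; rewrite if_same.
Qed.

Definition trunc (p : pred int) (A : lser) : lser :=
  lser_of (trunc_bounded p A).

End Series.
Arguments lser {K} V.

Section Laurent.
Context {R : realType}.

(* The field C((z^-1)), which is also the component J_0 of the operators. *)
Definition laurent := @lser R[i] (R[i])^o.

Implicit Types (f g : laurent) (q : R[i]).

Definition zpow (k : int) : laurent := mono k (1 : (R[i])^o).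

(* The Cauchy product; the sum has finitely many nonzero terms. *)
Fact lmul_bounded f g :
  bounded_above
    ((fun k => \sum_(i \in [set: int]) (f i * g (k - i))) : int -> (R[i])^o).
Proof.
have /bounded_predP[N fN] := coef_bounded f.
have /bounded_predP[M gM] := coef_bounded g.
exists (N + M) => k NMk; apply: fsbig1 => i _.
case: (ltP N i) => [/fN ->|iN]; first by rewrite mul0r.
by rewrite gM ?mulr0// ltrBrDr; apply: le_lt_trans NMk; rewrite addrC lerD2r.
Qed.

Definition lmul f g : laurent := lser_of (lmul_bounded f g).

(* \int f dz/z *)
Definition residue f : R[i] := f 0.

Fact diag_bounded (s : int -> R[i]) f :
  bounded_above ((fun k => s k * f k) : int -> (R[i])^o).
Proof.
have /bounded_predP[N fN] := coef_bounded f.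
by exists N => k /fN ->; rewrite mulr0.
Qed.

(* The operator z^k |-> s k z^k. *)
Definition diag (s : int -> R[i]) f : laurent := lser_of (diag_bounded s f).

(* \hat h ^ i, where (\hat h f)(z) = f (q z) *)
Definition hpow q (i : int) : laurent -> laurent := diag (fun k => q ^ (i * k)).

(* rho(\hat h ^ n) P_0' for a rational function rho: the mode z^k, k <> 0, is
   multiplied by rho (q ^ (n k)), and the constant mode is killed. *)
Definition ratP0' q (n : nat) (rho : R[i] -> R[i]) : laurent -> laurent :=
  diag (fun k => if k == 0 then 0 else rho (q ^ (n%:Z * k))).

(* The restriction of P_00 to J_0. *)
Definition P00 f : laurent := residue f *: zpow 0.

(* Equality a^* = b for the form <f, g> = \int f g dz/z. *)
Definition adjoint (a b : laurent -> laurent) : Prop :=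
  forall f g, residue (lmul (a f) g) = residue (lmul f (b g)).

End Laurent.
Arguments laurent R : clear implicits.

Section Operators.
Context {R : realType} (q : R[i]).

Definition PsiD := @lser R[i] (laurent R).

Implicit Types (A B L P U V X Y : PsiD).

(* The product determined by D a = (\hat h a) D. *)
Fact pmul_bounded A B :
  bounded_above
    (fun k => \sum_(i \in [set: int]) lmul (A i) (hpow q i (B (k - i)))).
Proof.
have /bounded_predP[N AN] := coef_bounded A.
have /bounded_predP[M BM] := coef_bounded B.
exists (N + M) => k NMk; apply: fsbig1 => i _.
apply/val_inj/funext => j; apply: fsbig1 => l _ /=.
case: (ltP N i) => [/AN ->|iN]; first by rewrite mul0r.
by rewrite BM ?mulr0 ?mulr0// ltrBrDr; apply: le_lt_trans NMk; rewrite addrC lerD2r.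
Qed.

Definition pmul A B : PsiD := lser_of (pmul_bounded A B).

Definition inJ0 (f : laurent R) : PsiD := mono 0 f.

Definition ppow A (m : nat) : PsiD := iter m (pmul A) (inJ0 (zpow 0)).

Definition commutator A B : PsiD := pmul A B - pmul B A.

Definition Pplus : PsiD -> PsiD := trunc (fun i => 0 < i).
Definition Pminus : PsiD -> PsiD := trunc (fun i => i < 0).
Definition Pnonneg : PsiD -> PsiD := trunc (fun i => 0 <= i).
Definition P0 A : laurent R := A 0.

Definition rmap A : PsiD := 2^-1 *: (Pplus A - Pminus A).

Definition Tr A : R[i] := residue (P0 A).

Definition pairing A B : R[i] := Tr (pmul A B).

Definition pairing2 (X Y : PsiD * PsiD) : R[i] :=
  pairing X.1 Y.1 - pairing X.2 Y.2.

(* [S] is an affine subspace and [L] one of its points; the derivative is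
   taken along the directions of [S] only.  With [S = setT] this is the
   gradient on the whole space.  The derivative in t is the complex one. *)
Definition is_gradient (S : set PsiD) (phi : PsiD -> R[i]) L U : Prop :=
  forall X, (forall t : R[i], S (L + t *: X)) ->
    is_derive (0 : (R[i])^o) (1 : (R[i])^o)
      ((fun t : R[i] => phi (L + t *: X)) : (R[i])^o -> (R[i])^o)
      (pairing U X).

Definition smooth (phi : PsiD -> R[i]) : Prop :=
  forall L, exists U, is_gradient setT phi L U.

Definition grad (phi : PsiD -> R[i]) L : PsiD :=
  xget 0 [set U | is_gradient setT phi L U].

(* The operator matrix (r + a P_0, b P_0; c P_0, r + d P_0). *)
Definition Rmatrix (a b c d : laurent R -> laurent R) (X : PsiD * PsiD) :
    PsiD * PsiD :=
  (rmap X.1 + inJ0 (a (P0 X.1)) + inJ0 (b (P0 X.2)),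
   inJ0 (c (P0 X.1)) + rmap X.2 + inJ0 (d (P0 X.2))).

(* The value at L of the bracket of two functionals whose gradients at L are
   U and V; (L U, U L) is the pair of left and right gradients. *)
Definition bracket_at (a b c d : laurent R -> laurent R) L U V : R[i] :=
  pairing2 (Rmatrix a b c d (pmul L U, pmul U L)) (pmul L V, pmul V L).

Definition functional := PsiD -> R[i].

Definition bracket (a b c d : laurent R -> laurent R)
    (phi psi : functional) : functional :=
  fun L => bracket_at a b c d L (grad phi L) (grad psi L).

(* The generator A |-> Tr (z^-j A D^-i). *)
Definition coordinate (i j : int) : functional :=
  fun A => Tr (pmul (pmul (inJ0 (zpow (- j))) A) (mono (- i) (zpow 0))).

Definition functional_algebra (F : set functional) : Prop :=
  [/\ forall k : R[i], F (cst k),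
      forall phi psi, F phi -> F psi -> F (phi \+ psi) &
      forall phi psi, F phi -> F psi -> F (phi \* psi)].

Definition poisson_algebra (F : set functional)
    (br : functional -> functional -> functional) : Prop :=
  [/\ functional_algebra F,
      forall phi psi, F phi -> F psi -> F (br phi psi),
      forall phi psi L, F phi -> F psi -> br phi psi L = - br psi phi L,
      forall (k : R[i]) phi psi chi L, F phi -> F psi -> F chi ->
        br (cst k \* phi \+ psi) chi L = k * br phi chi L + br psi chi L
        /\ br (phi \* psi) chi L = phi L * br psi chi L + br phi chi L * psi L &
      forall phi psi chi L, F phi -> F psi -> F chi ->
        br (br phi psi) chi L + br (br psi chi) phi L
          + br (br chi phi) psi L = 0].

(* The bracket of two polynomials in the coordinates is a series, not a
   polynomial, in the coordinates.  A Poisson bracket is therefore a bracket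
   making some algebra of smooth functionals that contains all coordinates
   into a Poisson algebra. *)
Definition poisson_bracket (br : functional -> functional -> functional) :
    Prop :=
  exists F : set functional,
    [/\ forall phi, F phi -> smooth phi,
        forall i j, F (coordinate i j) &
        poisson_algebra F br].

Definition poisson_submanifold (br : functional -> functional -> functional)
    (S : set PsiD) : Prop :=
  forall phi psi, smooth phi -> smooth psi ->
    (exists k : R[i], forall L, S L -> phi L = k) ->
    forall L, S L -> br phi psi L = 0.

(* Operators D^n + u_(n-1) D^(n-1) + ... + u_0. *)
Definition Mn (n : nat) : set PsiD :=
  [set L | [/\ L n%:Z = zpow 0, forall i : int, n%:Z < i -> L i = 0 &
               forall i : int, i < 0 -> L i = 0]].

Definition is_root (n : nat) L P : Prop :=
  [/\ P 1 = zpow 0, forall i : int, 1 < i -> P i = 0 & ppow P n = L].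

Definition root (n : nat) L : PsiD := xget 0 [set P | is_root n L P].

Definition fracpow (n m : nat) L : PsiD := ppow (root n L) m.

Definition hamiltonian (n m : nat) : functional :=
  fun L => n%:R / m%:R * Tr (fracpow n m L).

(* A functional H on S generates dL/dt = W L on S: for every psi the
   derivative <dpsi(L), W L> of psi along W is {H, psi}(L). *)
Definition generates (a b c d : laurent R -> laurent R) (S : set PsiD)
    (H : functional) (W : PsiD -> PsiD) : Prop :=
  forall L U psi, S L -> is_gradient S H L U -> smooth psi ->
    pairing (grad psi L) (W L) = bracket_at a b c d L U (grad psi L).

Definition in_involution (a b c d : laurent R -> laurent R) (S : set PsiD)
    (H H' : functional) : Prop :=
  forall L U U', S L -> is_gradient S H L U -> is_gradient S H' L U' ->
    bracket_at a b c d L U U' = 0.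

Definition lax_hamiltonians (a b c d : laurent R -> laurent R) (n : nat) :
    Prop :=
  [/\ forall m L, (0 < m)%N -> Mn n L ->
        exists U, is_gradient (Mn n) (hamiltonian n m) L U,
      forall m m', (0 < m)%N -> (0 < m')%N ->
        in_involution a b c d (Mn n) (hamiltonian n m) (hamiltonian n m') &
      forall m, (0 < m)%N ->
        generates a b c d (Mn n) (hamiltonian n m)
          (fun L => commutator (Pnonneg (fracpow n m L)) L)].

Definition gelfand_dickey_bracket (n : nat)
    (br : functional -> functional -> functional) : Prop :=
  exists a b c d : {linear laurent R -> laurent R},
    [/\ [/\ adjoint a (\- a), adjoint d (\- d) & adjoint c b],
        br = bracket a b c d,
        poisson_bracket br,
        poisson_submanifold br (Mn n) &
        lax_hamiltonians a b c d n].

End Operators.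
Arguments PsiD R : clear implicits.
Arguments functional R : clear implicits.

(* Main.v *)
Require Import Defs.
From HB Require Import structures.
From mathcomp Require Import all_boot all_order all_algebra.
From mathcomp Require Import all_classical all_reals all_analysis.
From mathcomp Require Import complex zify ring.

Set Implicit Arguments.
Unset Strict Implicit.
Unset Printing Implicit Defensive.

Import Order.TTheory GRing.Theory Num.Theory.
Import numFieldNormedType.Exports.
Local Open Scope classical_set_scope.
Local Open Scope ring_scope.

(** Write h for the dilation of z by q and <A, B> for Tr AB.  If phi and psi
    have gradients U and V at L, the bracket at L is <X_U, V>, where X_U is
    R_1 L - L R_2 and (R_1, R_2) is the image of (LU, UL) under the operator
    matrix ([hamfield], [bracket_atE]).

    Jacobi identity.  It holds for all a, b, c, d with a = -a^*, d = -d^*,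
    c^* = b.  On one component, R is [rmap] plus some map into J_0, and then
    the cyclic sum of Tr (Rx Ry z) is -1/4 Tr (xyz) up to terms symmetric in x
    and y ([cybe]): in a triple of degrees of sum 0, either all three vanish
    or exactly one of the pairs decides the sign.  So the antisymmetrized
    cyclic sums on the two components are the same multiple of
    Tr (xyz) - Tr (yxz) for (LU, LV, LW) and for (UL, VL, WL), and these agree
    because the trace is cyclic.  The terms with second derivatives cancel by
    symmetry of the Hessians ([bracket_jacobi]).  The Poisson algebra consists
    of the traces of noncommutative polynomials in L in which linear maps
    with an adjoint may be applied ([regular]).  Transposing the derivative of
    such an expression gives an expression of the same kind, so these
    functionals have gradients and are closed under the bracket.

    Tangency.  For L in M_n the field X_U has degrees between 0 and n, and its
    coefficient of D^n is
      (a - 1/2 - h^n c) f + (b + 1/2 h^n - h^n d) g,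
    with f = (LU)_0 and g = (UL)_0 ([hamfield_top]).  The affine subspace M_n
    is a Poisson submanifold when this vanishes for all f and g that have the
    same residue.

    Lax equations.  The gradient of H_m is U = L^-1 L^(m/n)
    ([hamiltonian_gradient]): the coefficients of L^(1/n) are found one after
    the other by inverting 1 + h + ... + h^(n-1), which is possible because q
    is not a root of unity, so that each of them is polynomial along lines in
    M_n.  For this U, the field X_U is the Lax field up to the terms
    (a + b - 1/2) f . L and L . (c + d - 1/2) f, where f = (L^(m/n))_0
    ([hamfield_lax]).  For the four operators of the theorem the coefficient
    of D^n and these extra terms vanish, mode by mode ([gd_exists]).

    Uniqueness.  The operator L = D^n + 1 suffices to read off from tangency
    that a = 1/2 + h^n c and b = h^n d - 1/2 h^n on series without constant
    term, and the equation of H_n = Tr L at L = D^n + z^j forces (a + b - 1/2) z^j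
    and (c + d - 1/2) z^j to be one and the same constant ([gd_rigid]).  With the
    adjointness conditions this fixes all matrix entries of a, b, c, d between
    nonzero modes.  The entries that remain free change R_1 and R_2 by the same
    constant ([rigid_const]), hence do not change the bracket, since LV and VL
    have the same trace. *)

(** * Finitely supported sums over the integers *)

Section IntSums.
Context {V : zmodType}.
Implicit Types (F G : int -> V).

Definition window (lo hi : int) : seq int :=
  if lo <= hi then [seq lo + m%:Z | m <- iota 0 (absz (hi - lo + 1))] else [::].

Lemma window_uniq lo hi : uniq (window lo hi).
Proof.
rewrite /window; case: ifP => // _.
by rewrite map_inj_uniq ?iota_uniq// => i j; lia.
Qed.

Lemma mem_window (lo hi i : int) : (i \in window lo hi) = (lo <= i <= hi).
Proof.
rewrite /window; case: ifP => lohi; last by rewrite in_nil; lia.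
apply/mapP/idP => [[m]|]; first by rewrite mem_iota; lia.
by exists (absz (i - lo)); [rewrite mem_iota; lia|lia].
Qed.

Lemma fsum_seq F (r : seq int) : uniq r -> (forall i, i \notin r -> F i = 0) ->
  \sum_(i \in [set: int]) F i = \sum_(i <- r) F i.
Proof.
move=> ur Fr; rewrite (fsbigE r F ur)//; last by move=> i _; exact: Fr.
by apply: eq_bigl => i; rewrite in_setT.
Qed.

Lemma fsum_window F lo hi : (forall i, F i != 0 -> lo <= i /\ i <= hi) ->
  \sum_(i \in [set: int]) F i = \sum_(i <- window lo hi) F i.
Proof.
move=> FW; apply: fsum_seq; first exact: window_uniq.
by move=> i; apply: contraNeq => /FW/andP; rewrite mem_window.
Qed.

Lemma fsum_shift F (j : int) :
  \sum_(i \in [set: int]) F i = \sum_(i \in [set: int]) F (i - j).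
Proof.
apply: (reindex_fsbigT (fun i : int => i - j)).
by exists (fun i => i + j) => i; rewrite ?addrK ?subrK.
Qed.

Lemma fsum_opp F :
  \sum_(i \in [set: int]) F i = \sum_(i \in [set: int]) F (- i).
Proof.
apply: (reindex_fsbigT (fun i : int => - i)).
by exists (fun i => - i) => i; rewrite opprK.
Qed.

End IntSums.

(** * Cauchy products *)

Section Convolution.

Definition vanishes_above {V : zmodType} (f : int -> V) (N : int) :=
  forall i, N < i -> f i = 0.

Definition biadditive {U V W : zmodType} (B : U -> V -> W) :=
  (forall x y z, B (x + y) z = B x z + B y z) /\
  (forall x y z, B x (y + z) = B x y + B x z).

Lemma biadditive0 {U V W : zmodType} (B : U -> V -> W) : biadditive B ->
  (forall y, B 0 y = 0) /\ (forall x, B x 0 = 0).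
Proof.
move=> [Bl Br]; split=> [y|x].
  by apply: (addrI (B 0 y)); rewrite -Bl !addr0.
by apply: (addrI (B x 0)); rewrite -Br !addr0.
Qed.

Lemma biadditive_suml {U V W : zmodType} (B : U -> V -> W) I (r : seq I) F y :
  biadditive B -> B (\sum_(i <- r) F i) y = \sum_(i <- r) B (F i) y.
Proof.
move=> bB; elim: r => [|i r IH]; first by rewrite !big_nil (biadditive0 bB).1.
by rewrite !big_cons bB.1 IH.
Qed.

Lemma biadditive_sumr {U V W : zmodType} (B : U -> V -> W) I (r : seq I) F x :
  biadditive B -> B x (\sum_(i <- r) F i) = \sum_(i <- r) B x (F i).
Proof.
move=> bB; elim: r => [|i r IH]; first by rewrite !big_nil (biadditive0 bB).2.
by rewrite !big_cons bB.2 IH.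
Qed.

(** The operation combining the coefficients may depend on the left index: this
    is how the twist D a = (h a) D enters the product of operators. *)
Definition cprod {U V W : zmodType} (B : int -> U -> V -> W)
    (f : int -> U) (g : int -> V) (k : int) : W :=
  \sum_(i \in [set: int]) B i (f i) (g (k - i)).

Lemma cprod_support {U V W : zmodType} (B : int -> U -> V -> W) f g N M k i :
  (forall i, biadditive (B i)) -> vanishes_above f N -> vanishes_above g M ->
  B i (f i) (g (k - i)) != 0 -> k - M <= i /\ i <= N.
Proof.
move=> bB fN gM H; split; rewrite leNgt; apply: contra_neqN H => H.
  by rewrite gM ?(biadditive0 (bB i)).2//; lia.
by rewrite fN// (biadditive0 (bB i)).1.
Qed.

Lemma cprod_window {U V W : zmodType} (B : int -> U -> V -> W) f g N M k lo hi :
  (forall i, biadditive (B i)) -> vanishes_above f N -> vanishes_above g M ->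
  lo <= k - M -> N <= hi ->
  cprod B f g k = \sum_(i <- window lo hi) B i (f i) (g (k - i)).
Proof.
move=> bB fN gM lok Nhi; apply: fsum_window => i.
by move=> /(cprod_support bB fN gM); lia.
Qed.

Lemma cprod_vanishes {U V W : zmodType} (B : int -> U -> V -> W) f g N M :
  (forall i, biadditive (B i)) -> vanishes_above f N -> vanishes_above g M ->
  vanishes_above (cprod B f g) (N + M).
Proof.
move=> bB fN gM k NMk; apply: fsbig1 => i _; apply/eqP/negPn/negP.
by move=> /(cprod_support bB fN gM); lia.
Qed.

Lemma cprod_top {U V W : zmodType} (B : int -> U -> V -> W) f g N M :
  (forall i, biadditive (B i)) -> vanishes_above f N -> vanishes_above g M ->
  cprod B f g (N + M) = B N (f N) (g M).
Proof.
move=> bB fN gM; rewrite /cprod (@fsum_seq _ _ [:: N])// ?big_seq1.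
  by congr (B _ _ (g _)); lia.
move=> i; rewrite inE; apply: contraNeq => /(cprod_support bB fN gM).
by move=> ?; apply/eqP; lia.
Qed.

(** Bounds on the three supports confine the double sums on both sides to one
    finite box, over which the summations can be exchanged. *)
Lemma cprodA {X Y Z XY YZ W : zmodType} (B : int -> X -> Y -> XY)
    (C : int -> XY -> Z -> W) (D : int -> X -> YZ -> W) (E : int -> Y -> Z -> YZ)
    f g h N M K :
  (forall i, biadditive (B i)) -> (forall i, biadditive (C i)) ->
  (forall i, biadditive (D i)) -> (forall i, biadditive (E i)) ->
  (forall i j x y z, C (i + j) (B i x y) z = D i x (E j y z)) ->
  vanishes_above f N -> vanishes_above g M -> vanishes_above h K ->
  cprod C (cprod B f g) h = cprod D f (cprod E g h).
Proof.
move=> bB bC bD bE BCDE fN gM hK; apply/funext => k.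
rewrite (@cprod_window _ _ _ C _ _ (N + M) K _ (k - K) (N + M))//; last 1 first.
  exact: cprod_vanishes.
rewrite (@cprod_window _ _ _ D _ _ N (M + K) _ (k - K - M) N)//; last 2 first.
- exact: cprod_vanishes.
- lia.
under eq_big_seq => i.
  rewrite mem_window => Hi.
  rewrite (@cprod_window _ _ _ B _ _ N M _ (k - K - M) N)//; last by lia.
  rewrite (biadditive_suml _ _ _ (bC i)).
  over.
under [RHS]eq_big_seq => j.
  rewrite mem_window => Hj.
  rewrite /cprod (fsum_shift _ j).
  rewrite (@fsum_window _ _ (k - K) (N + M)); last first.
    by move=> i /(cprod_support bE gM hK); lia.
  rewrite (biadditive_sumr _ _ _ (bD j)).
  over.
rewrite exchange_big/=; apply: eq_bigr => j _; apply: eq_bigr => i _.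
by rewrite -BCDE; congr (C _ _ (h _)); lia.
Qed.

Lemma cprodDl {U V W : zmodType} (B : int -> U -> V -> W) f f' g N M :
  (forall i, biadditive (B i)) -> vanishes_above f N -> vanishes_above f' N ->
  vanishes_above g M ->
  cprod B (fun i => f i + f' i) g = (fun k => cprod B f g k + cprod B f' g k).
Proof.
move=> bB fN f'N gM; apply/funext => k.
rewrite !(@cprod_window _ _ _ B _ _ N M _ (k - M) N)//.
  by rewrite -big_split; apply: eq_bigr => i _; rewrite (bB i).1.
by move=> i Ni; rewrite fN// f'N// addr0.
Qed.

Lemma cprodDr {U V W : zmodType} (B : int -> U -> V -> W) f g g' N M :
  (forall i, biadditive (B i)) -> vanishes_above f N -> vanishes_above g M ->
  vanishes_above g' M ->
  cprod B f (fun i => g i + g' i) = (fun k => cprod B f g k + cprod B f g' k).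
Proof.
move=> bB fN gM g'M; apply/funext => k.
rewrite !(@cprod_window _ _ _ B _ _ N M _ (k - M) N)//.
  by rewrite -big_split; apply: eq_bigr => i _; rewrite (bB i).2.
by move=> i Ni; rewrite gM// g'M// addr0.
Qed.

End Convolution.

(** * Laurent series *)

Section SeriesCoef.
Context {K : pzRingType} {V : lmodType K}.
Implicit Types (A B : lser V).

Lemma lserP A B : (forall i, A i = B i) -> A = B.
Proof. by move=> AB; apply/val_inj/funext. Qed.

Lemma lcoefD A B i : (A + B) i = A i + B i. Proof. by []. Qed.
Lemma lcoefB A B i : (A - B) i = A i - B i. Proof. by []. Qed.
Lemma lcoefN A i : (- A) i = - A i. Proof. by []. Qed.
Lemma lcoefZ a A i : (a *: A) i = a *: A i. Proof. by []. Qed.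
Lemma lcoef0 i : (0 : lser V) i = 0. Proof. by []. Qed.
Lemma lcoef_sum I (r : seq I) (F : I -> lser V) i :
  (\sum_(j <- r) F j) i = \sum_(j <- r) F j i.
Proof. by elim: r => [|j r IH]; rewrite ?big_nil// !big_cons lcoefD IH. Qed.

Lemma coef_mono k v i : (mono k v : lser V) i = if i == k then v else 0.
Proof. by []. Qed.

Lemma coef_trunc (p : pred int) A i : trunc p A i = if p i then A i else 0.
Proof. by []. Qed.

Lemma lser_vanishes A : exists N, vanishes_above A N.
Proof. by have /bounded_predP := coef_bounded A. Qed.

Lemma lser_vanishes2 A B : exists N, vanishes_above A N /\ vanishes_above B N.
Proof.
have [N AN] := lser_vanishes A; have [M BM] := lser_vanishes B.
exists (Num.max N M); split=> i; rewrite gt_max => /andP[? ?]; [exact: AN|exact: BM].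
Qed.

End SeriesCoef.

Section LaurentAlgebra.
Context {R : realType}.
Local Notation C := R[i].
Implicit Types (f g h : laurent R) (q : C).

Lemma lmulE f g k : lmul f g k = cprod (fun _ (x y : C) => x * y) f g k.
Proof. by []. Qed.

Lemma laurentZ a f k : (a *: f) k = a * f k. Proof. by []. Qed.

Let mul_biadd (i : int) : biadditive (fun x y : C => x * y).
Proof. by split=> x y z; rewrite ?mulrDl ?mulrDr. Qed.

Lemma lmulA f g h : lmul f (lmul g h) = lmul (lmul f g) h.
Proof.
have [N fN] := lser_vanishes f; have [M gM] := lser_vanishes g.
have [K hK] := lser_vanishes h.
apply/val_inj/esym.
pose m := fun (_ : int) (x y : C) => x * y.
apply: (@cprodA _ _ _ _ _ _ m m m m f g h N M K) => // *.
by rewrite /m mulrA.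
Qed.

Lemma lmulC f g : lmul f g = lmul g f.
Proof.
apply/lserP => k; rewrite !lmulE /cprod (fsum_shift _ (- k)) fsum_opp.
by apply: eq_fsbigr => i _; rewrite mulrC; congr (g _ * f _); lia.
Qed.

Lemma lmulDl f g h : lmul (f + g) h = lmul f h + lmul g h.
Proof.
have [N [fN gN]] := lser_vanishes2 f g; have [M hM] := lser_vanishes h.
apply/val_inj.
exact: (@cprodDl _ _ _ (fun (_ : int) (x y : C) => x * y) f g h N M).
Qed.

Lemma lmulDr f g h : lmul f (g + h) = lmul f g + lmul f h.
Proof. by rewrite lmulC lmulDl !(lmulC f). Qed.

Lemma lmul_biadd : biadditive (@lmul R).
Proof. by split=> *; rewrite ?lmulDl ?lmulDr. Qed.

Lemma lmul0l f : lmul 0 f = 0. Proof. exact: (biadditive0 lmul_biadd).1. Qed.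
Lemma lmul0r f : lmul f 0 = 0. Proof. exact: (biadditive0 lmul_biadd).2. Qed.

Lemma lmul_monol j (v : C) f k : lmul (mono j (v : C^o)) f k = v * f (k - j).
Proof.
rewrite lmulE /cprod (@fsum_seq _ _ [:: j])// ?big_seq1 ?coef_mono ?eqxx//.
by move=> i; rewrite inE coef_mono => /negPf ->; rewrite mul0r.
Qed.

Lemma lmulZl a f g : lmul (a *: f) g = a *: lmul f g.
Proof.
have mono_scale h : lmul (mono 0 (a : C^o)) h = a *: h.
  by apply/lserP => k; rewrite lmul_monol subr0 laurentZ.
by rewrite -!mono_scale lmulA.
Qed.

Lemma lmulZr a f g : lmul f (a *: g) = a *: lmul f g.
Proof. by rewrite lmulC lmulZl lmulC. Qed.

Lemma lmul1l f : lmul (zpow 0) f = f.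
Proof. by apply/lserP => k; rewrite lmul_monol mul1r subr0. Qed.

Lemma lmul1r f : lmul f (zpow 0) = f.
Proof. by rewrite lmulC lmul1l. Qed.

Lemma lmulNl f g : lmul (- f) g = - lmul f g.
Proof. by rewrite -scaleN1r lmulZl scaleN1r. Qed.

Lemma lmulNr f g : lmul f (- g) = - lmul f g.
Proof. by rewrite lmulC lmulNl lmulC. Qed.

Lemma lmulBl f g h : lmul (f - g) h = lmul f h - lmul g h.
Proof. by rewrite lmulDl lmulNl. Qed.

Lemma lmulBr f g h : lmul f (g - h) = lmul f g - lmul f h.
Proof. by rewrite lmulDr lmulNr. Qed.

Lemma coef_diag s f k : diag s f k = s k * f k. Proof. by []. Qed.

Lemma diag_linear s : linear (@diag R s).
Proof.
move=> a f g; apply/lserP => k; rewrite lcoefD laurentZ !coef_diag lcoefD laurentZ.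
by rewrite mulrDr mulrCA.
Qed.

Lemma hpow_linear q i : linear (@hpow R q i).
Proof. exact: diag_linear. Qed.

HB.instance Definition _ q i :=
  GRing.isLinear.Build C (laurent R) (laurent R) *:%R (hpow q i) (hpow_linear q i).
HB.instance Definition _ s :=
  GRing.isLinear.Build C (laurent R) (laurent R) *:%R (diag s) (diag_linear s).

Lemma coef_hpow q i f k : hpow q i f k = q ^ (i * k) * f k. Proof. by []. Qed.

Lemma hpow0 q f : hpow q 0 f = f.
Proof. by apply/lserP => k; rewrite coef_hpow mul0r expr0z mul1r. Qed.

Lemma hpow_zpow0 q i : hpow q i (zpow 0) = zpow 0.
Proof.
apply/lserP => k; rewrite coef_hpow coef_mono; case: eqVneq => [->|_].
  by rewrite mulr0 expr0z mulr1.
by rewrite mulr0.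
Qed.

Lemma hpowD q i j f : q != 0 -> hpow q i (hpow q j f) = hpow q (i + j) f.
Proof.
by move=> q0; apply/lserP => k; rewrite !coef_hpow mulrA -expfzDr// mulrDl.
Qed.

Lemma hpowM q i f g : q != 0 ->
  hpow q i (lmul f g) = lmul (hpow q i f) (hpow q i g).
Proof.
move=> q0; apply/lserP => k; rewrite coef_hpow !lmulE.
have [N fN] := lser_vanishes f; have [M gM] := lser_vanishes g.
have bN := fun i => @mul_biadd i.
rewrite !(@cprod_window _ _ _ _ _ _ N M _ (k - M) N)//; last 2 first.
- by move=> j Nj; rewrite coef_hpow fN// mulr0.
- by move=> j Nj; rewrite coef_hpow gM// mulr0.
rewrite mulr_sumr; apply: eq_bigr => j _; rewrite !coef_hpow.
rewrite mulrACA -expfzDr// -mulrDr; congr (q ^ (i * _) * _); lia.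
Qed.

Lemma residueD f g : residue (f + g) = residue f + residue g. Proof. by []. Qed.
Lemma residueZ a f : residue (a *: f) = a * residue f. Proof. by []. Qed.

(** The residue is invariant under dilations, so [hpow q (- i)] is the adjoint
    of [hpow q i]. *)
Lemma residue_hpow q i f g : q != 0 ->
  residue (lmul (hpow q i f) g) = residue (lmul f (hpow q (- i) g)).
Proof.
move=> q0; have -> : lmul (hpow q i f) g = hpow q i (lmul f (hpow q (- i) g)).
  by rewrite hpowM// hpowD// addrN hpow0.
by rewrite /residue coef_hpow mulr0 expr0z mul1r.
Qed.

Lemma residue_zpow f k : residue (lmul f (zpow (- k))) = f k.
Proof. by rewrite lmulC /residue lmul_monol mul1r sub0r opprK. Qed.

End LaurentAlgebra.

(** * Operators and the trace *)

Section OperatorAlgebra.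
Context {R : realType} (q : R[i]).
Local Notation C := R[i].
Local Notation PsiD := (PsiD R).
Local Notation pmul := (pmul q).
Implicit Types (A B X Y Z : PsiD) (f g : laurent R).

Definition pid : PsiD := inJ0 (zpow 0).

Lemma pmulE A B k :
  pmul A B k = cprod (fun i x y => lmul x (hpow q i y)) A B k.
Proof. by []. Qed.

Let twist_biadd i : biadditive (fun x y : laurent R => lmul x (hpow q i y)).
Proof. by split=> x y z; rewrite ?linearD ?lmulDl ?lmulDr. Qed.

Lemma pmulA (q0 : q != 0) A B X : pmul A (pmul B X) = pmul (pmul A B) X.
Proof.
have [N AN] := lser_vanishes A; have [M BM] := lser_vanishes B.
have [K XK] := lser_vanishes X.
apply/val_inj/esym.
pose m := fun i x y => lmul x (hpow q i y).
apply: (@cprodA _ _ _ _ _ _ m m m m A B X N M K) => // i j x y z.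
by rewrite /m hpowM// hpowD// lmulA.
Qed.

Lemma pmulDl A B X : pmul (A + B) X = pmul A X + pmul B X.
Proof.
have [N [AN BN]] := lser_vanishes2 A B; have [M XM] := lser_vanishes X.
apply/val_inj.
exact: (@cprodDl _ _ _ (fun i x y => lmul x (hpow q i y)) A B X N M).
Qed.

Lemma pmulDr A B X : pmul A (B + X) = pmul A B + pmul A X.
Proof.
have [N [BN XN]] := lser_vanishes2 B X; have [M AM] := lser_vanishes A.
apply/val_inj.
exact: (@cprodDr _ _ _ (fun i x y => lmul x (hpow q i y)) A B X M N).
Qed.

Lemma pmul_biadd : biadditive pmul.
Proof. by split=> *; rewrite ?pmulDl ?pmulDr. Qed.

Lemma pmul0l A : pmul 0 A = 0. Proof. exact: (biadditive0 pmul_biadd).1. Qed.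
Lemma pmul0r A : pmul A 0 = 0. Proof. exact: (biadditive0 pmul_biadd).2. Qed.

Lemma pmulZl a A B : pmul (a *: A) B = a *: pmul A B.
Proof.
apply/lserP => k; have [N AN] := lser_vanishes A; have [M BM] := lser_vanishes B.
rewrite lcoefZ !pmulE !(@cprod_window _ _ _ _ _ _ N M _ (k - M) N)//.
  by rewrite scaler_sumr; apply: eq_bigr => i _; rewrite lcoefZ lmulZl.
by move=> j Nj; rewrite lcoefZ AN// scaler0.
Qed.

Lemma pmulZr a A B : pmul A (a *: B) = a *: pmul A B.
Proof.
apply/lserP => k; have [N AN] := lser_vanishes A; have [M BM] := lser_vanishes B.
rewrite lcoefZ !pmulE !(@cprod_window _ _ _ _ _ _ N M _ (k - M) N)//.
  by rewrite scaler_sumr; apply: eq_bigr => i _; rewrite lcoefZ linearZ/= lmulZr.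
by move=> j Nj; rewrite lcoefZ BM// scaler0.
Qed.

Lemma pmulNl A B : pmul (- A) B = - pmul A B.
Proof. by rewrite -scaleN1r pmulZl scaleN1r. Qed.
Lemma pmulNr A B : pmul A (- B) = - pmul A B.
Proof. by rewrite -scaleN1r pmulZr scaleN1r. Qed.
Lemma pmulBl A B X : pmul (A - B) X = pmul A X - pmul B X.
Proof. by rewrite pmulDl pmulNl. Qed.
Lemma pmulBr A B X : pmul A (B - X) = pmul A B - pmul A X.
Proof. by rewrite pmulDr pmulNr. Qed.

Lemma pmul_monol j (v : laurent R) A k :
  pmul (mono j v) A k = lmul v (hpow q j (A (k - j))).
Proof.
rewrite pmulE /cprod (@fsum_seq _ _ [:: j])// ?big_seq1 ?coef_mono ?eqxx//.
by move=> i; rewrite inE coef_mono => /negPf ->; rewrite lmul0l.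
Qed.

Lemma pmul_monor j (v : laurent R) A k :
  pmul A (mono j v) k = lmul (A (k - j)) (hpow q (k - j) v).
Proof.
rewrite pmulE /cprod (@fsum_seq _ _ [:: k - j])// ?big_seq1 ?coef_mono.
  by rewrite ifT//; apply/eqP; lia.
move=> i; rewrite inE coef_mono => /eqP ikj.
by rewrite ifF ?linear0 ?lmul0r//; apply/eqP; lia.
Qed.

Lemma pmul_inJ0l f A k : pmul (inJ0 f) A k = lmul f (A k).
Proof. by rewrite pmul_monol hpow0 subr0. Qed.

Lemma pmul_inJ0r f A k : pmul A (inJ0 f) k = lmul (A k) (hpow q k f).
Proof. by rewrite pmul_monor subr0. Qed.

Lemma pmul1l A : pmul pid A = A.
Proof. by apply/lserP => k; rewrite pmul_inJ0l lmul1l. Qed.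

Lemma pmul1r A : pmul A pid = A.
Proof. by apply/lserP => k; rewrite pmul_inJ0r hpow_zpow0 lmul1r. Qed.

Lemma pmul_vanishes A B N M : vanishes_above A N -> vanishes_above B M ->
  vanishes_above (pmul A B) (N + M).
Proof. exact: (@cprod_vanishes _ _ _ (fun i x y => lmul x (hpow q i y)) A B N M). Qed.

Lemma pmul_top A B N M : vanishes_above A N -> vanishes_above B M ->
  pmul A B (N + M) = lmul (A N) (hpow q N (B M)).
Proof. exact: (@cprod_top _ _ _ (fun i x y => lmul x (hpow q i y)) A B N M). Qed.

Lemma inJ0_linear : linear (@inJ0 R).
Proof.
move=> a f g; apply/lserP => i; rewrite lcoefD lcoefZ !coef_mono.
by case: ifP => //; rewrite scaler0 addr0.
Qed.

Lemma trunc_linear (p : pred int) : linear (@trunc C (laurent R) p).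
Proof.
move=> a A B; apply/lserP => i; rewrite lcoefD lcoefZ !coef_trunc lcoefD lcoefZ.
by case: ifP => //; rewrite scaler0 addr0.
Qed.

Lemma residueN f : residue (- f) = - residue f. Proof. by []. Qed.

Lemma TrD A B : Tr (A + B) = Tr A + Tr B.
Proof. by rewrite /Tr /P0 lcoefD residueD. Qed.
Lemma TrN A : Tr (- A) = - Tr A.
Proof. by rewrite /Tr /P0 lcoefN residueN. Qed.
Lemma TrZ a A : Tr (a *: A) = a * Tr A.
Proof. by rewrite /Tr /P0 lcoefZ residueZ. Qed.

Lemma TrM A B :
  Tr (pmul A B) = \sum_(i \in [set: int]) residue (lmul (A i) (hpow q i (B (- i)))).
Proof.
have [N AN] := lser_vanishes A; have [M BM] := lser_vanishes B.
rewrite /Tr /P0 pmulE (@cprod_window _ _ _ _ _ _ N M _ (- M) N)//; last by lia.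
rewrite /residue lcoef_sum (@fsum_window _ _ (- M) N).
  by apply: eq_bigr => i _; rewrite sub0r.
move=> i /eqP H; split; rewrite leNgt; apply/negP => Hi; apply: H.
  by rewrite BM ?linear0 ?lmul0r//; lia.
by rewrite AN// lmul0l.
Qed.

Lemma TrC (q0 : q != 0) A B : Tr (pmul A B) = Tr (pmul B A).
Proof.
rewrite !TrM fsum_opp; apply: eq_fsbigr => i _.
by rewrite opprK lmulC residue_hpow// opprK.
Qed.

Lemma TrCA (q0 : q != 0) A B X : Tr (pmul (pmul A B) X) = Tr (pmul (pmul B X) A).
Proof. by rewrite -pmulA// TrC. Qed.

End OperatorAlgebra.

(** * Polynomial curves *)

Lemma is_derive_horner (K : numFieldType) (w v : K) (f : K -> K) :
  is_derive (0 : K^o) (1 : K^o) (f : K^o -> K^o) v ->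
  is_derive (0 : K^o) (1 : K^o) ((fun t => w + t * f t) : K^o -> K^o) (f 0).
Proof.
move=> fv.
have idD := is_derive_id (0 : K^o) (1 : K^o).
have prodD := @is_deriveM K K^o _ _ _ _ _ _ idD fv.
have H := is_deriveD (is_derive_cst (w : K^o) (0 : K^o) (1 : K^o)) prodD.
apply: (is_derive_eq H).
by rewrite add0r scale0r add0r /GRing.scale/= mulr1.
Qed.

Section PolynomialCurves.
Context {R : realType}.
Local Notation C := R[i].

(** [pcurve f v]: the curve [f] is polynomial in its parameter and its
    derivative at 0 is [v].  The Horner form makes closure under bilinear
    operations a structural induction and needs no topology on the target. *)
Inductive pcurve {V : lmodType C} : (C -> V) -> V -> Prop :=
| pcurve_cst v : pcurve (fun=> v) 0
| pcurve_horner w f v : pcurve f v -> pcurve (fun t => w + t *: f t) (f 0).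

Lemma pcurve_eq {V : lmodType C} (f g : C -> V) v w :
  pcurve f v -> (forall t, g t = f t) -> w = v -> pcurve g w.
Proof. by move=> fv /funext -> ->. Qed.

Lemma pcurveD {V : lmodType C} (f g : C -> V) v w :
  pcurve f v -> pcurve g w -> pcurve (fun t => f t + g t) (v + w).
Proof.
move=> fv; elim: fv g w => {f v} [v|u f v fv IH] g w gw.
  case: gw => {g w} [w|w g v' gv'].
    by rewrite addr0; exact: pcurve_cst.
  apply: pcurve_eq (pcurve_horner (v + w) gv') _ (add0r _).
  by move=> t; rewrite addrA.
case: gw => {g w} [w|w g v' gv'].
  apply: pcurve_eq (pcurve_horner (u + w) fv) _ (addr0 _).
  by move=> t; rewrite addrAC.
apply: pcurve_eq (pcurve_horner (u + w) (IH _ _ gv')) _ _ => //.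
by move=> t; rewrite scalerDr addrACA.
Qed.

Lemma pcurve_line {V : lmodType C} (x y : V) : pcurve (fun t => x + t *: y) y.
Proof. exact: (pcurve_horner x (pcurve_cst y)). Qed.

Lemma pcurve_lin {V W : lmodType C} (T : V -> W) (f : C -> V) v :
  linear T -> pcurve f v -> pcurve (fun t => T (f t)) (T v).
Proof.
move=> lT; have T0 : T 0 = 0.
  by have := lT (-1) 0 0; rewrite scaleN1r oppr0 addr0 scaleN1r addNr.
elim=> {f v} [v|w f v fv IH]; first by rewrite T0; exact: pcurve_cst.
apply: pcurve_eq (pcurve_horner (T w) IH) _ _ => //.
by move=> t; rewrite addrC lT addrC.
Qed.

Lemma pcurve_bilin {U V W : lmodType C} (B : U -> V -> W) f g v w :
  (forall x, linear (B x)) -> (forall y, linear (B^~ y)) ->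
  pcurve f v -> pcurve g w ->
  pcurve (fun t => B (f t) (g t)) (B v (g 0) + B (f 0) w).
Proof.
move=> lr ll fv; have B0 y : B 0 y = 0.
  by have := ll y (-1) 0 0; rewrite scaleN1r oppr0 addr0 scaleN1r addNr.
elim: fv g w => {f v} [v|u f v fv IH] g w gw.
  by rewrite B0 add0r; exact: pcurve_lin.
apply: pcurve_eq
  (pcurveD (pcurve_lin (lr u) gw) (pcurve_horner 0 (IH _ _ gw))) _ _.
  by move=> t; rewrite add0r addrC ll addrC.
by rewrite scale0r addr0 addrC.
Qed.

Lemma pcurve_sum {V : lmodType C} I (r : seq I) (F : I -> C -> V) (v : I -> V) :
  (forall i, pcurve (F i) (v i)) ->
  pcurve (fun t => \sum_(i <- r) F i t) (\sum_(i <- r) v i).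
Proof.
move=> Fv; elim: r => [|i r IH].
  by apply: pcurve_eq (pcurve_cst 0) _ _ => [t|]; rewrite !big_nil.
by apply: pcurve_eq (pcurveD (Fv i) IH) _ _ => [t|]; rewrite !big_cons.
Qed.

Lemma pcurve_derive (f : C -> C) (v : C) :
  @pcurve (C^o) f v -> is_derive (0 : C^o) (1 : C^o) (f : C^o -> C^o) v.
Proof.
elim=> {f v} [v|w f v fv IH]; first exact: is_derive_cst.
exact: (@is_derive_horner R[i] w v f IH).
Qed.

Lemma pcurve_unique (f : C -> C) (v w : C) :
  @pcurve (C^o) f v -> @pcurve (C^o) f w -> v = w.
Proof.
move=> /pcurve_derive fv /pcurve_derive fw.
by have := @derive_val _ _ _ _ _ _ _ fw; rewrite (@derive_val _ _ _ _ _ _ _ fv).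
Qed.

End PolynomialCurves.

(** * The trace form *)

Section TraceForm.
Context {R : realType} (q : R[i]) (q0 : q != 0).
Local Notation C := R[i].
Local Notation PsiD := (PsiD R).
Local Notation pmul := (pmul q).
Let pmulA := pmulA q0.
Let TrC := TrC q0.
Let TrCA := TrCA q0.
Local Notation pairing := (pairing q).
Implicit Types (A B X Y Z L U V : PsiD) (f g : laurent R).

Lemma pairingC A B : pairing A B = pairing B A.
Proof. exact: TrC. Qed.

Lemma pairingDl A B X : pairing (A + B) X = pairing A X + pairing B X.
Proof. by rewrite /pairing pmulDl TrD. Qed.
Lemma pairingDr A B X : pairing X (A + B) = pairing X A + pairing X B.
Proof. by rewrite /pairing pmulDr TrD. Qed.
Lemma pairingNl A X : pairing (- A) X = - pairing A X.
Proof. by rewrite /pairing pmulNl TrN. Qed.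
Lemma pairingNr A X : pairing X (- A) = - pairing X A.
Proof. by rewrite /pairing pmulNr TrN. Qed.
Lemma pairingBl A B X : pairing (A - B) X = pairing A X - pairing B X.
Proof. by rewrite pairingDl pairingNl. Qed.
Lemma pairingBr A B X : pairing X (A - B) = pairing X A - pairing X B.
Proof. by rewrite pairingDr pairingNr. Qed.
Lemma pairingZl a A X : pairing (a *: A) X = a * pairing A X.
Proof. by rewrite /pairing pmulZl TrZ. Qed.
Lemma pairingZr a A X : pairing X (a *: A) = a * pairing X A.
Proof. by rewrite /pairing pmulZr TrZ. Qed.
Lemma pairing0r X : pairing X 0 = 0.
Proof. by rewrite -(scale0r 0) pairingZr mul0r. Qed.

Lemma pairingMl A B X : pairing (pmul A B) X = pairing A (pmul B X).
Proof. by rewrite /pairing pmulA. Qed.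
Lemma pairingMr A B X : pairing (pmul A B) X = pairing B (pmul X A).
Proof. by rewrite /pairing TrCA// pmulA. Qed.

Lemma pairing_linear X : linear (pairing X : PsiD -> C^o).
Proof. by move=> a A B; rewrite pairingDr pairingZr. Qed.

Lemma pairing_mono U i f :
  pairing U (mono i f) = residue (lmul (U (- i)) (hpow q (- i) f)).
Proof. by rewrite /pairing /Tr /P0 pmul_monor sub0r. Qed.

Lemma pairing_inJ0 f B : pairing (inJ0 f) B = residue (lmul f (P0 B)).
Proof. by rewrite /pairing /Tr /P0 pmul_inJ0l. Qed.

Lemma pairing1 A : pairing A pid = Tr A.
Proof. by rewrite /pairing pmul1r. Qed.

Lemma hpow_zpow i j : hpow q i (zpow j) = q ^ (i * j) *: zpow j.
Proof.
apply/lserP => k; rewrite coef_hpow laurentZ coef_mono.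
by case: eqVneq => [->|_]; rewrite ?mulr0.
Qed.

Lemma pairing_monomial U i j :
  pairing U (mono (- i) (zpow (- j))) = q ^ (i * - j) * U i j.
Proof.
by rewrite pairing_mono opprK hpow_zpow lmulZr residueZ residue_zpow.
Qed.

(** Pairing with monomials recovers the coefficients, so gradients on the whole
    space are unique. *)
Lemma pairing_nondegenerate U V :
  (forall X, pairing U X = pairing V X) -> U = V.
Proof.
move=> UV; apply/lserP => i; apply/lserP => j.
have := UV (mono (- i) (zpow (- j))); rewrite !pairing_monomial.
by apply: mulfI; rewrite expfz_neq0.
Qed.

Lemma pairing_trunc (p : pred int) A B :
  pairing (trunc p A) B = pairing A (trunc (fun i => p (- i)) B).
Proof.
rewrite /pairing !TrM; apply: eq_fsbigr => i _; rewrite !coef_trunc opprK.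
by case: ifP => // _; rewrite lmul0l linear0 lmul0r.
Qed.

Lemma pairing_Pplus A B : pairing (Pplus A) B = pairing A (Pminus B).
Proof.
rewrite /Pplus /Pminus pairing_trunc; congr (pairing A (trunc _ B)).
by apply/funext => i; lia.
Qed.

Lemma pairing_Pminus A B : pairing (Pminus A) B = pairing A (Pplus B).
Proof. by rewrite pairingC -pairing_Pplus pairingC. Qed.

Lemma pairing_rmap A B : pairing (rmap A) B = - pairing A (rmap B).
Proof.
rewrite /rmap pairingZl pairingZr pairingBl pairingBr.
by rewrite pairing_Pplus pairing_Pminus; ring.
Qed.

Lemma rmap_linear : linear (@rmap R).
Proof.
move=> a A B; rewrite /rmap /Pplus /Pminus !trunc_linear.
move: (trunc _ A) (trunc _ A) (trunc _ B) (trunc _ B) => A1 A2 B1 B2.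
rewrite opprD.
rewrite addrACA.
rewrite -scalerBr.
rewrite scalerDr.
rewrite !scalerA.
by rewrite [_ * a]mulrC.
Qed.

Lemma triangular A : A = Pplus A + inJ0 (P0 A) + Pminus A.
Proof.
apply/lserP => i; rewrite !lcoefD !coef_trunc coef_mono.
by case: (ltgtP i 0) => i0; rewrite ?addr0 ?add0r// i0.
Qed.

End TraceForm.

(** * The Yang-Baxter identity *)

Section YangBaxter.
Context {R : realType} (q : R[i]) (q0 : q != 0).
Local Notation C := R[i].
Local Notation PsiD := (PsiD R).
Local Notation pmul := (pmul q).
Let pmulA := pmulA q0.
Let TrC := TrC q0.
Let TrCA := TrCA q0.
Implicit Types (A B X Y Z L U V x y z : PsiD) (f g : laurent R).

Definition vanishes_below {V : zmodType} (f : int -> V) (N : int) :=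
  forall i, i < N -> f i = 0.

Lemma pmul_vanishes_below A B N M : vanishes_below A N -> vanishes_below B M ->
  vanishes_below (pmul A B) (N + M).
Proof.
move=> AN BM k kNM; apply: fsbig1 => i _.
case: (ltP i N) => [iN|Ni]; first by rewrite AN// lmul0l.
by rewrite BM ?linear0 ?lmul0r//; lia.
Qed.

Definition Tr3 x y z : C := Tr (pmul (pmul x y) z).

Lemma Tr3C x y z : Tr3 x y z = Tr3 y z x.
Proof. exact: TrCA. Qed.
Lemma Tr3Dl x x' y z : Tr3 (x + x') y z = Tr3 x y z + Tr3 x' y z.
Proof. by rewrite /Tr3 !pmulDl TrD. Qed.
Lemma Tr3Zl a x y z : Tr3 (a *: x) y z = a * Tr3 x y z.
Proof. by rewrite /Tr3 !pmulZl TrZ. Qed.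
Lemma Tr3Dm x y y' z : Tr3 x (y + y') z = Tr3 x y z + Tr3 x y' z.
Proof. by rewrite ![Tr3 x _ z]Tr3C Tr3Dl. Qed.
Lemma Tr3Zm a x y z : Tr3 x (a *: y) z = a * Tr3 x y z.
Proof. by rewrite ![Tr3 x _ z]Tr3C Tr3Zl. Qed.
Lemma Tr3Dr x y z z' : Tr3 x y (z + z') = Tr3 x y z + Tr3 x y z'.
Proof. by rewrite /Tr3 pmulDr TrD. Qed.
Lemma Tr3Zr a x y z : Tr3 x y (a *: z) = a * Tr3 x y z.
Proof. by rewrite /Tr3 pmulZr TrZ. Qed.
Lemma Tr3Nl x y z : Tr3 (- x) y z = - Tr3 x y z.
Proof. by rewrite -scaleN1r Tr3Zl mulN1r. Qed.
Lemma Tr3Nm x y z : Tr3 x (- y) z = - Tr3 x y z.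
Proof. by rewrite -scaleN1r Tr3Zm mulN1r. Qed.
Lemma Tr3Nr x y z : Tr3 x y (- z) = - Tr3 x y z.
Proof. by rewrite -scaleN1r Tr3Zr mulN1r. Qed.

Lemma Tr3_above x y z a b c : vanishes_above x a -> vanishes_above y b ->
  vanishes_above z c -> a + b + c < 0 -> Tr3 x y z = 0.
Proof.
move=> xa yb zc abc; have xy := pmul_vanishes q xa yb.
by rewrite /Tr3 /Tr /P0 (pmul_vanishes q xy zc).
Qed.

Lemma Tr3_below x y z a b c : vanishes_below x a -> vanishes_below y b ->
  vanishes_below z c -> 0 < a + b + c -> Tr3 x y z = 0.
Proof.
move=> xa yb zc abc; have xy := pmul_vanishes_below xa yb.
by rewrite /Tr3 /Tr /P0 (pmul_vanishes_below xy zc).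
Qed.

Lemma Pplus_below x : vanishes_below (Pplus x) 1.
Proof. by move=> i i1; rewrite coef_trunc; case: ifP => //; lia. Qed.
Lemma Pminus_above x : vanishes_above (Pminus x) (-1).
Proof. by move=> i i1; rewrite coef_trunc; case: ifP => //; lia. Qed.
Lemma inJ0_below f : vanishes_below (inJ0 f) 0.
Proof. by move=> i i1; rewrite coef_mono; case: eqP => //; lia. Qed.
Lemma inJ0_above f : vanishes_above (inJ0 f) 0.
Proof. by move=> i i1; rewrite coef_mono; case: eqP => //; lia. Qed.

Lemma inJ0M f g : pmul (inJ0 f) (inJ0 g) = inJ0 (lmul f g).
Proof.
by apply/lserP => i; rewrite pmul_inJ0l !coef_mono; case: ifP; rewrite ?lmul0r.
Qed.

Lemma Tr3_inJ0C f g x : Tr3 (inJ0 f) (inJ0 g) x = Tr3 (inJ0 g) (inJ0 f) x.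
Proof. by rewrite /Tr3 !inJ0M lmulC. Qed.

Lemma rmap_inJ0M f x : rmap (pmul (inJ0 f) x) = pmul (inJ0 f) (rmap x).
Proof.
rewrite /rmap pmulZr pmulBr; congr (_ *: (_ - _)); apply/lserP => i;
  by rewrite coef_trunc !pmul_inJ0l coef_trunc; case: ifP; rewrite ?lmul0r.
Qed.

(** Split x, y, z into positive, constant and negative parts.  A product of
    parts has nonzero trace only if all three are constant or if both signs
    occur.  In the second case the products of signs of the three pairs, the
    sign of a constant part being 0, add up to -1. *)
Lemma rmap_cyclic x y z :
  Tr3 (rmap x) (rmap y) z + Tr3 (rmap y) (rmap z) x + Tr3 (rmap z) (rmap x) y =
  2^-1 * 2^-1 * (Tr3 (inJ0 (P0 x)) (inJ0 (P0 y)) (inJ0 (P0 z)) - Tr3 x y z).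
Proof.
have -> : Tr3 (rmap y) (rmap z) x = Tr3 x (rmap y) (rmap z) by rewrite [RHS]Tr3C.
have -> : Tr3 (rmap z) (rmap x) y = Tr3 (rmap x) y (rmap z) by rewrite [LHS]Tr3C.
rewrite /rmap !(Tr3Zl, Tr3Zm, Tr3Zr).
move: (triangular x) (triangular y) (triangular z).
move: (@Pplus_below x) (@Pplus_below y) (@Pplus_below z).
move: (@Pminus_above x) (@Pminus_above y) (@Pminus_above z).
move: (@inJ0_below (P0 x)) (@inJ0_below (P0 y)) (@inJ0_below (P0 z)).
move: (@inJ0_above (P0 x)) (@inJ0_above (P0 y)) (@inJ0_above (P0 z)).
move: (Pplus x) (Pplus y) (Pplus z) (Pminus x) (Pminus y) (Pminus z).
move: (inJ0 (P0 x)) (inJ0 (P0 y)) (inJ0 (P0 z)).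
move=> ox oy oz px py pz mx my mz aox aoy aoz box boy boz amx amy amz.
move=> bpx bpy bpz -> -> ->.
rewrite !(Tr3Dl, Tr3Dm, Tr3Dr, Tr3Nl, Tr3Nm, Tr3Nr).
rewrite (Tr3_below bpx bpy bpz)// (Tr3_below bpx bpy boz)//.
rewrite (Tr3_below bpx boy bpz)// (Tr3_below box bpy bpz)//.
rewrite (Tr3_below bpx boy boz)// (Tr3_below box boy bpz)//.
rewrite (Tr3_below box bpy boz)//.
rewrite (Tr3_above amx amy amz)// (Tr3_above amx amy aoz)//.
rewrite (Tr3_above amx aoy amz)// (Tr3_above aox amy amz)//.
rewrite (Tr3_above amx aoy aoz)// (Tr3_above aox aoy amz)//.
rewrite (Tr3_above aox amy aoz)//.
ring.
Qed.

(** Multiplication by an element of J_0 preserves degrees, so it commutes with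
    [rmap], which is skew. *)
Lemma rmap_ladjoint f x y :
  Tr3 (inJ0 f) (rmap x) y = - Tr3 (inJ0 f) x (rmap y).
Proof. by rewrite /Tr3 -rmap_inJ0M -!/(pairing q _ _) pairing_rmap. Qed.

(** This replaces the modified Yang-Baxter equation of R, whose other terms are
    moved by skewness.  Mixed terms in f, g, h cancel by [rmap_ladjoint]; terms
    with two of them and the purely constant term of [rmap_cyclic] are
    symmetric because J_0 is commutative.  The elements f, g, h are arbitrary
    since R mixes the two components of the double. *)
Lemma cybe x y z f g h :
  let Rx := rmap x + inJ0 f in
  let Ry := rmap y + inJ0 g in
  let Rz := rmap z + inJ0 h in
  Tr3 Rx Ry z - Tr3 Ry Rx z + (Tr3 Ry Rz x - Tr3 Rz Ry x)
    + (Tr3 Rz Rx y - Tr3 Rx Rz y) =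
  2^-1 * 2^-1 * (Tr3 y x z - Tr3 x y z).
Proof.
move=> /=; rewrite !(Tr3Dl, Tr3Dm).
have H1 := rmap_cyclic x y z; have H2 := rmap_cyclic y x z.
rewrite (Tr3_inJ0C (P0 y) (P0 x)) in H2.
have f1 := rmap_ladjoint f y z; have f2 := rmap_ladjoint f z y.
have g1 := rmap_ladjoint g z x; have g2 := rmap_ladjoint g x z.
have h1 := rmap_ladjoint h x y; have h2 := rmap_ladjoint h y x.
rewrite (Tr3_inJ0C g f) (Tr3_inJ0C h g) (Tr3_inJ0C f h).
rewrite (Tr3C (rmap x) (inJ0 g) z) (Tr3C (rmap y) (inJ0 f) z).
rewrite (Tr3C (rmap y) (inJ0 h) x) (Tr3C (rmap z) (inJ0 g) x).
rewrite (Tr3C (rmap z) (inJ0 f) y) (Tr3C (rmap x) (inJ0 h) y).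
have E : 2^-1 * 2^-1 * (Tr3 y x z - Tr3 x y z) =
  2^-1 * 2^-1 * (Tr3 (inJ0 (P0 x)) (inJ0 (P0 y)) (inJ0 (P0 z)) - Tr3 x y z)
  - 2^-1 * 2^-1 * (Tr3 (inJ0 (P0 x)) (inJ0 (P0 y)) (inJ0 (P0 z)) - Tr3 y x z).
  by ring.
rewrite E -H1 -H2.
by rewrite f1 f2 g1 g2 h1 h2; ring.
Qed.

End YangBaxter.

(** * Gradients and Hamiltonian fields *)

Section Gradients.
Context {R : realType} (q : R[i]) (q0 : q != 0).
Local Notation C := R[i].
Local Notation PsiD := (PsiD R).
Local Notation pmul := (pmul q).
Local Notation pairing := (pairing q).
Implicit Types (L U V X Y Z : PsiD) (phi psi : functional R).

Lemma is_gradient_unique (S : set PsiD) phi L U V X :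
  is_gradient q S phi L U -> is_gradient q S phi L V ->
  (forall t : C, S (L + t *: X)) -> pairing U X = pairing V X.
Proof.
move=> HU HV HS.
have eU := @derive_val _ _ _ _ _ _ _ (HU X HS).
have eV := @derive_val _ _ _ _ _ _ _ (HV X HS).
exact: etrans (esym eU) eV.
Qed.

Lemma gradE phi L U : is_gradient q setT phi L U -> grad q phi L = U.
Proof.
move=> HU; rewrite /grad; apply: (xget_unique _ HU) => V HV.
apply: (pairing_nondegenerate q0) => X; exact: (is_gradient_unique HV HU).
Qed.

Lemma smooth_grad phi L : smooth q phi -> is_gradient q setT phi L (grad q phi L).
Proof. by move=> /(_ L); exact: xgetPex. Qed.

Lemma pcurve_gradient (S : set PsiD) phi L U :
  (forall X, (forall t : C, S (L + t *: X)) ->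
     @pcurve R C^o (fun t => phi (L + t *: X)) (pairing U X)) ->
  is_gradient q S phi L U.
Proof. by move=> H X /H /pcurve_derive. Qed.

Lemma gradient_linear (S : set PsiD) V L : is_gradient q S (pairing V) L V.
Proof.
apply: pcurve_gradient => X _.
exact: (pcurve_lin (pairing_linear q V) (pcurve_line L X)).
Qed.

Lemma smooth_linear V : smooth q (pairing V).
Proof. by move=> L; exists V; exact: gradient_linear. Qed.

Lemma grad_linear V L : grad q (pairing V) L = V.
Proof. by apply: gradE; exact: gradient_linear. Qed.

End Gradients.

Section HamiltonianField.
Context {R : realType} (q : R[i]) (q0 : q != 0).
Local Notation C := R[i].
Local Notation PsiD := (PsiD R).
Local Notation pmul := (pmul q).
Local Notation pairing := (pairing q).
Local Notation pairing2 := (pairing2 q).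
Context (a b c d : {linear laurent R -> laurent R}).
Implicit Types (L U V X Y Z A B : PsiD).

Definition Rdiag (e : laurent R -> laurent R) A : PsiD :=
  rmap A + inJ0 (e (P0 A)).
Definition Roff (e : laurent R -> laurent R) A : PsiD := inJ0 (e (P0 A)).

Lemma RmatrixE (X : PsiD * PsiD) : Rmatrix a b c d X =
  (Rdiag a X.1 + Roff b X.2, Roff c X.1 + Rdiag d X.2).
Proof. by rewrite /Rmatrix /Rdiag /Roff addrA. Qed.

Lemma inJ0D (f g : laurent R) : inJ0 (f + g) = inJ0 f + inJ0 g.
Proof. by have := inJ0_linear 1 f g; rewrite !scale1r. Qed.

Lemma Rmatrix1E (X : PsiD * PsiD) : (Rmatrix a b c d X).1 =
  rmap X.1 + inJ0 (a (P0 X.1) + b (P0 X.2)).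
Proof. by rewrite inJ0D addrA. Qed.

Lemma Rmatrix2E (X : PsiD * PsiD) : (Rmatrix a b c d X).2 =
  rmap X.2 + inJ0 (c (P0 X.1) + d (P0 X.2)).
Proof. by rewrite inJ0D addrCA addrA. Qed.

Lemma Roff_linear (e : {linear laurent R -> laurent R}) : linear (Roff e).
Proof.
move=> k A B; rewrite /Roff -inJ0_linear; congr inJ0.
by rewrite -linearP.
Qed.

Lemma Rdiag_linear (e : {linear laurent R -> laurent R}) : linear (Rdiag e).
Proof.
move=> k A B; rewrite /Rdiag rmap_linear -/(Roff e _) Roff_linear.
by rewrite scalerDr addrACA.
Qed.

Definition hamfield L U : PsiD :=
  pmul (Rmatrix a b c d (pmul L U, pmul U L)).1 L -
  pmul L (Rmatrix a b c d (pmul L U, pmul U L)).2.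

Lemma bracket_atE L U V :
  bracket_at q a b c d L U V = pairing (hamfield L U) V.
Proof. by rewrite pairingBl pairingMl// [X in _ - X]pairingMr. Qed.

Hypotheses (ha : adjoint a (\- a)) (hd : adjoint d (\- d)) (hc : adjoint c b).

Lemma pairing_Roff (e e' : laurent R -> laurent R) A B : adjoint e e' ->
  pairing (Roff e A) B = pairing A (Roff e' B).
Proof.
by move=> ee'; rewrite [RHS]pairingC// !pairing_inJ0 ee' lmulC.
Qed.

Lemma pairing_Rdiag (e : laurent R -> laurent R) A B : adjoint e (\- e) ->
  pairing (Rdiag e A) B = - pairing A (Rdiag e B).
Proof.
move=> ee; rewrite pairingDl pairing_rmap// -/(Roff e A) (pairing_Roff _ _ ee).
rewrite pairingDr opprD; congr (_ + _).
rewrite [LHS]pairingC// [in RHS]pairingC// !pairing_inJ0.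
by rewrite -residueN -lmulNl.
Qed.

Lemma adjoint_sym : adjoint b c.
Proof. by move=> f g; rewrite lmulC -hc lmulC. Qed.

Lemma Rmatrix_skew (X Y : PsiD * PsiD) :
  pairing2 (Rmatrix a b c d X) Y = - pairing2 X (Rmatrix a b c d Y).
Proof.
have aE := pairing_Rdiag X.1 Y.1 ha; have dE := pairing_Rdiag X.2 Y.2 hd.
have bE := pairing_Roff X.2 Y.1 adjoint_sym.
have cE := pairing_Roff X.1 Y.2 hc.
move: aE bE cE dE; rewrite !RmatrixE /pairing2/=.
move: (Rdiag a X.1) (Roff b X.2) (Roff c X.1) (Rdiag d X.2).
move: (Rdiag a Y.1) (Roff b Y.2) (Roff c Y.1) (Rdiag d Y.2).
move=> ? ? ? ? ? ? ? ? aE bE cE dE; rewrite !pairingDl !pairingDr.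
by rewrite aE bE cE dE; ring.
Qed.

Lemma bracket_atC L U V :
  bracket_at q a b c d L U V = - bracket_at q a b c d L V U.
Proof.
rewrite /bracket_at Rmatrix_skew; congr (- _).
by rewrite /pairing2 (pairingC q0 (pmul L U)) (pairingC q0 (pmul U L)).
Qed.

End HamiltonianField.

(** * Regular functionals *)

Section RegularMaps.
Context {R : realType} (q : R[i]) (q0 : q != 0).
Local Notation C := R[i].
Local Notation PsiD := (PsiD R).
Local Notation pmul := (pmul q).
Local Notation pairing := (pairing q).
Implicit Types (L U V X Y Z A B : PsiD).
Implicit Types (E F G : PsiD -> PsiD) (dE dF dG : PsiD -> PsiD -> PsiD).
Implicit Types (T : PsiD -> PsiD).

Definition adjoint_pair T T' :=
  [/\ linear T, linear T' & forall A B, pairing (T A) B = pairing A (T' B)].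

(** [regular E dE]: [E] is a noncommutative polynomial in [L] with operator
    coefficients, in which linear maps having an adjoint may be applied, and
    [dE L X] is its formal derivative at [L] along [X].  Adjoints are what
    turns the derivative of a trace of such an expression into a pairing with
    an element of the algebra. *)
Inductive regular : (PsiD -> PsiD) -> (PsiD -> PsiD -> PsiD) -> Prop :=
| regular_id : regular (fun L => L) (fun _ X => X)
| regular_cst A : regular (fun=> A) (fun _ _ => 0)
| regular_add E dE F dF : regular E dE -> regular F dF ->
    regular (fun L => E L + F L) (fun L X => dE L X + dF L X)
| regular_mul E dE F dF : regular E dE -> regular F dF ->
    regular (fun L => pmul (E L) (F L))
            (fun L X => pmul (dE L X) (F L) + pmul (E L) (dF L X))
| regular_lin T T' E dE : adjoint_pair T T' -> regular E dE ->
    regular (fun L => T (E L)) (fun L X => T (dE L X)).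

Lemma pmul_linearl B : linear (pmul^~ B).
Proof. by move=> k X Y; rewrite pmulDl pmulZl. Qed.

Lemma pmul_linearr B : linear (pmul B).
Proof. by move=> k X Y; rewrite pmulDr pmulZr. Qed.

Lemma regular_curve E dE L X : regular E dE ->
  pcurve (fun t : C => E (L + t *: X)) (dE L X).
Proof.
elim=> {E dE} [|A|E dE F dF _ IE _ IF|E dE F dF _ IE _ IF|T T' E dE [lT _ _] _ IE].
- exact: pcurve_line.
- exact: pcurve_cst.
- exact: pcurveD.
- have := pcurve_bilin pmul_linearr pmul_linearl IE IF.
  by rewrite scale0r addr0.
- exact: pcurve_lin.
Qed.

(** The symmetry of the second derivative is what makes Hessians symmetric. *)
Lemma regular_second_derivative E dE : regular E dE ->
  exists d2E : PsiD -> PsiD -> PsiD -> PsiD,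
    (forall L X Y, pcurve (fun t : C => dE (L + t *: Y) X) (d2E L X Y)) /\
    (forall L X Y, d2E L X Y = d2E L Y X).
Proof.
elim=> {E dE}.
- exists (fun _ _ _ => 0); split=> // *; exact: pcurve_cst.
- move=> _; exists (fun _ _ _ => 0); split=> // *; exact: pcurve_cst.
- move=> E dE F dF _ [d2E [cE sE]] _ [d2F [cF sF]].
  exists (fun L X Y => d2E L X Y + d2F L X Y).
  by split=> [L X Y|L X Y]; [exact: pcurveD|rewrite sE sF].
- move=> E dE F dF rE [d2E [cE sE]] rF [d2F [cF sF]].
  exists (fun L X Y => (pmul (d2E L X Y) (F L) + pmul (dE L X) (dF L Y))
                     + (pmul (dE L Y) (dF L X) + pmul (E L) (d2F L X Y))).
  split=> L X Y.
    have := pcurveD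
      (pcurve_bilin pmul_linearr pmul_linearl (cE L X Y) (regular_curve L Y rF))
      (pcurve_bilin pmul_linearr pmul_linearl (regular_curve L Y rE) (cF L X Y)).
    by rewrite scale0r addr0.
  rewrite sE sF -!addrA; congr (_ + _); rewrite !addrA; congr (_ + _).
  exact: addrC.
- move=> T T' E dE [lT _ _] _ [d2E [cE sE]].
  exists (fun L X Y => T (d2E L X Y)).
  by split=> L X Y; [exact: pcurve_lin|rewrite sE].
Qed.

Lemma adjoint_pairC T T' : adjoint_pair T T' -> adjoint_pair T' T.
Proof.
move=> [lT lT' TT']; split=> // A B.
by rewrite pairingC// -TT' pairingC.
Qed.

(** The chain rule read backwards: the factor [X] at the leaves of the
    derivative is brought to the outside by cyclicity of the trace and by
    adjoints, and what remains is again built from the same operations. *)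
Lemma regular_transpose E dE : regular E dE -> forall G dG, regular G dG ->
  exists H dH, regular H dH /\
    forall L X, pairing (dE L X) (G L) = pairing (H L) X.
Proof.
elim=> {E dE}.
- by move=> G dG rG; exists G, dG; split=> // L X; rewrite pairingC.
- move=> A G dG rG; exists (fun=> 0), (fun _ _ => 0); split.
    exact: regular_cst.
  by move=> L X; rewrite pairingC// !pairing0r// pairingC// pairing0r.
- move=> E dE F dF _ IE _ IF G dG rG.
  have [H [dH [rH HE]]] := IE _ _ rG; have [K [dK [rK KE]]] := IF _ _ rG.
  exists (fun L => H L + K L), (fun L X => dH L X + dK L X).
  by split=> [|L X]; [exact: regular_add|rewrite !pairingDl HE KE].
- move=> E dE F dF rE IE rF IF G dG rG.
  have [H [dH [rH HE]]] := IE _ _ (regular_mul rF rG).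
  have [K [dK [rK KE]]] := IF _ _ (regular_mul rG rE).
  exists (fun L => H L + K L), (fun L X => dH L X + dK L X).
  split=> [|L X]; first exact: regular_add.
  by rewrite !pairingDl -HE -KE pairingMl// pairingMr.
- move=> T T' E dE TT' _ IE G dG rG.
  have [H [dH [rH HE]]] := IE _ _ (regular_lin (adjoint_pairC TT') rG).
  by exists H, dH; split=> // L X; rewrite -HE; case: TT'.
Qed.

(** The bracket of two coordinates is not a polynomial in coordinates, as it
    involves infinitely many of them; traces of regular maps contain the
    coordinates and are closed under brackets. *)
Definition regular_functional : set (functional R) :=
  [set phi | exists E dE, regular E dE /\ phi = fun L => Tr (E L)].

Lemma Tr_linear : linear (@Tr R : PsiD -> C^o).
Proof. by move=> k A B; rewrite TrD TrZ. Qed.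

Lemma regular_Tr_gradient E dE L U : regular E dE ->
  (forall X, Tr (dE L X) = pairing U X) ->
  is_gradient q setT (fun L => Tr (E L)) L U.
Proof.
move=> rE UE; apply: pcurve_gradient => X _; rewrite -UE.
exact: (pcurve_lin Tr_linear (regular_curve L X rE)).
Qed.

(** The gradient is the transpose of the derivative of [E] applied to 1.  That
    it is regular keeps brackets inside the algebra; the symmetry of its
    derivative, the Hessian, is needed for the Jacobi identity. *)
Lemma regular_gradient E dE : regular E dE ->
  exists (U : PsiD -> PsiD) (dU : PsiD -> PsiD -> PsiD), [/\ regular U dU,
    grad q (fun L => Tr (E L)) = U,
    forall L X, Tr (dE L X) = pairing (U L) X &
    forall L X Y, pairing (dU L Y) X = pairing (dU L X) Y].
Proof.
move=> rE.
have [U [dU [rU UE]]] := regular_transpose rE (regular_cst pid).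
have {}UE L X : Tr (dE L X) = pairing (U L) X by rewrite -UE pairing1.
exists U, dU; split=> // [|L X Y].
  by apply/funext => L; apply: (gradE q0); exact: (regular_Tr_gradient rE (UE L)).
have [d2E [cE sE]] := regular_second_derivative rE.
have hess A B : pairing (dU L B) A = Tr (d2E L A B).
  have c1 := pcurve_lin Tr_linear (cE L A B).
  have c2 := pcurve_lin (pairing_linear q A) (regular_curve L B rU).
  rewrite pairingC//; apply: (pcurve_unique c2); apply: pcurve_eq c1 _ _ => // t.
  by rewrite UE pairingC.
by rewrite !hess sE.
Qed.

Lemma regular_functional_smooth phi : regular_functional phi -> smooth q phi.
Proof.
move=> [E [dE [rE ->]]] L.
have [U [dU [rU _ UE _]]] := regular_gradient rE.
by exists (U L); exact: (regular_Tr_gradient rE (UE L)).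
Qed.

Lemma adjoint_pairZ (k : C) : adjoint_pair ( *:%R k) ( *:%R k).
Proof.
by split=> [l A B|l A B|A B]; rewrite ?scalerDr ?scalerA 1?mulrC//
  pairingZl pairingZr.
Qed.

(** This self-adjoint map turns a trace into a scalar operator, so that products
    of traces are traces of regular maps. *)
Lemma adjoint_pair_Tr :
  adjoint_pair (fun A => Tr A *: pid) (fun A => Tr A *: pid).
Proof.
have lin : linear (fun A => Tr A *: pid : PsiD).
  by move=> k A B; rewrite TrD TrZ scalerDl scalerA.
split=> // A B; rewrite pairingZl pairingZr pairing1 pairingC// pairing1.
exact: mulrC.
Qed.

Lemma coordinate_regular i j : regular_functional (coordinate q i j).
Proof.
exists (fun A => pmul (pmul (inJ0 (zpow (- j))) A) (mono (- i) (zpow 0))).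
eexists; split; last by [].
by do 2 ?[apply: regular_mul]; [exact: regular_cst|exact: regular_id|exact: regular_cst].
Qed.

Lemma regular_functional_algebra : functional_algebra regular_functional.
Proof.
have Tr1 : Tr (pid : PsiD) = 1 by [].
split.
- move=> k; exists (fun=> k *: pid), (fun _ _ => 0); split.
    exact: regular_cst.
  by apply/funext => L; rewrite TrZ Tr1 mulr1.
- move=> _ _ [E [dE [rE ->]]] [F [dF [rF ->]]].
  exists (fun L => E L + F L), (fun L X => dE L X + dF L X).
  by split; [exact: regular_add|apply/funext => L; rewrite TrD].
- move=> _ _ [E [dE [rE ->]]] [F [dF [rF ->]]].
  have := regular_mul (regular_lin adjoint_pair_Tr rE) rF.
  set G := (fun L => pmul _ _); set dG := (fun L X => _) => rG.
  exists G, dG; split=> //; apply/funext => L.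
  by rewrite /G pmulZl pmul1l TrZ.
Qed.

End RegularMaps.

(** * Poisson brackets *)

Section PoissonAlgebra.
Context {R : realType} (q : R[i]) (q0 : q != 0).
Local Notation C := R[i].
Local Notation PsiD := (PsiD R).
Local Notation pmul := (pmul q).
Local Notation pairing := (pairing q).
Local Notation pairing2 := (pairing2 q).
Local Notation T3 := (Tr3 q).
Local Notation regular := (regular q).
Context (a b c d : {linear laurent R -> laurent R}).
Hypotheses (ha : adjoint a (\- a)) (hd : adjoint d (\- d)) (hc : adjoint c b).
Implicit Types (L X Y Z A B : PsiD).
Local Notation RM := (Rmatrix a b c d).
Local Notation brk := (bracket_at q a b c d).
Local Notation hamfield := (hamfield q a b c d).
Local Notation br := (bracket q a b c d).

Lemma adjoint_pair_Rdiag (e : {linear laurent R -> laurent R}) :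
  adjoint e (\- e) -> adjoint_pair q (Rdiag e) (fun A => - Rdiag e A).
Proof.
move=> ee; split; first exact: Rdiag_linear.
  by move=> k A B; rewrite Rdiag_linear opprD scalerN.
by move=> A B; rewrite pairing_Rdiag// pairingNr.
Qed.

Lemma adjoint_pair_Roff (e e' : {linear laurent R -> laurent R}) :
  adjoint e e' -> adjoint_pair q (Roff e) (Roff e').
Proof.
move=> ee'; split; [exact: Roff_linear|exact: Roff_linear|].
by move=> A B; exact: pairing_Roff.
Qed.

(** The trace of this expression is the bracket of functionals with gradients
    [U] and [V]; [dbracket_op] is its formal derivative. *)
Definition bracket_op (U V : PsiD -> PsiD) L : PsiD :=
  pmul (Rdiag a (pmul L (U L)) + Roff b (pmul (U L) L)) (pmul L (V L)) +
  (-1) *: pmul (Roff c (pmul L (U L)) + Rdiag d (pmul (U L) L)) (pmul (V L) L).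

Definition dbracket_op (U V : PsiD -> PsiD) (dU dV : PsiD -> PsiD -> PsiD) L X
    : PsiD :=
  (pmul (Rdiag a (pmul X (U L) + pmul L (dU L X)) +
         Roff b (pmul (dU L X) L + pmul (U L) X)) (pmul L (V L)) +
   pmul (Rdiag a (pmul L (U L)) + Roff b (pmul (U L) L))
        (pmul X (V L) + pmul L (dV L X))) +
  (-1) *: (pmul (Roff c (pmul X (U L) + pmul L (dU L X)) +
                 Rdiag d (pmul (dU L X) L + pmul (U L) X)) (pmul (V L) L) +
           pmul (Roff c (pmul L (U L)) + Rdiag d (pmul (U L) L))
                (pmul (dV L X) L + pmul (V L) X)).

Lemma regular_bracket_op U dU V dV : regular U dU -> regular V dV ->
  regular (bracket_op U V) (dbracket_op U V dU dV).
Proof.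
move=> rU rV.
have rLU := regular_mul (regular_id q) rU.
have rUL := regular_mul rU (regular_id q).
have rLV := regular_mul (regular_id q) rV.
have rVL := regular_mul rV (regular_id q).
have pb := adjoint_pair_Roff (adjoint_sym hc).
have pc := adjoint_pair_Roff hc.
have r1 := regular_add (regular_lin (adjoint_pair_Rdiag ha) rLU) (regular_lin pb rUL).
have r2 := regular_add (regular_lin pc rLU) (regular_lin (adjoint_pair_Rdiag hd) rUL).
exact: (regular_add (regular_mul r1 rLV)
  (regular_lin (adjoint_pairZ q (-1)) (regular_mul r2 rVL))).
Qed.

Lemma Tr_bracket_op (U V : PsiD -> PsiD) L : Tr (bracket_op U V L) = brk L (U L) (V L).
Proof.
rewrite /bracket_op TrD TrZ mulN1r.
by rewrite /bracket_at RmatrixE /pairing2.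
Qed.

Definition Rform (X Y : PsiD * PsiD) : C := pairing2 (RM X) Y.

Lemma RformDl (x1 x2 x1' x2' : PsiD) (Y : PsiD * PsiD) :
  Rform (x1 + x1', x2 + x2') Y = Rform (x1, x2) Y + Rform (x1', x2') Y.
Proof.
have add1 (T : PsiD -> PsiD) x y : linear T -> T (x + y) = T x + T y.
  by move=> lT; rewrite -[x in LHS]scale1r lT scale1r.
rewrite /Rform !RmatrixE /pairing2/=.
rewrite !(add1 _ _ _ (Rdiag_linear _)) !(add1 _ _ _ (Roff_linear _)).
by rewrite addrACA (addrACA (Roff c x1)) !pairingDl; ring.
Qed.

Lemma RformDr (X : PsiD * PsiD) (y1 y2 y1' y2' : PsiD) :
  Rform X (y1 + y1', y2 + y2') = Rform X (y1, y2) + Rform X (y1', y2').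
Proof. by rewrite /Rform /pairing2/= !pairingDr; ring. Qed.

Lemma Tr_dbracket_op (U V : PsiD -> PsiD) (dU dV : PsiD -> PsiD -> PsiD) L X :
  Tr (dbracket_op U V dU dV L X) =
  Rform (pmul X (U L), pmul (U L) X) (pmul L (V L), pmul (V L) L) +
  Rform (pmul L (U L), pmul (U L) L) (pmul X (V L), pmul (V L) X) +
  (brk L (dU L X) (V L) + brk L (U L) (dV L X)).
Proof.
have -> : Tr (dbracket_op U V dU dV L X) =
  Rform (pmul X (U L) + pmul L (dU L X), pmul (U L) X + pmul (dU L X) L)
        (pmul L (V L), pmul (V L) L) +
  Rform (pmul L (U L), pmul (U L) L)
        (pmul X (V L) + pmul L (dV L X), pmul (V L) X + pmul (dV L X) L).
  rewrite /dbracket_op TrD TrZ !TrD mulN1r /Rform !RmatrixE /pairing2.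
  rewrite [pmul (U L) X + _]addrC [pmul (V L) X + _]addrC.
  move: (Rdiag a _ + _) (Rdiag a _ + _) (Roff c _ + _) (Roff c _ + _).
  by move=> *; rewrite /pairing/=; ring.
by rewrite RformDl RformDr /bracket_at -/(Rform _ _) -/(Rform _ _); ring.
Qed.

Lemma hamfieldE L U V : brk L U V = pairing (hamfield L U) V.
Proof. exact: bracket_atE. Qed.

(* The traces in which both components of R occur; they enter the Leibniz
   expansion below symmetrically and cancel in cyclic sums. *)
Let mixed L x y W := T3 (pmul x L) y W.

(** The part of the derivative of a bracket along a third Hamiltonian field that
    contains no derivative of a gradient, in terms of the values (p1, p2),
    (s1, s2), (c1, c2) of R on the three pairs of left and right gradients. *)
Lemma Rform_leibniz L X U V p1 p2 s1 s2 c1 c2 :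
  RM (pmul L U, pmul U L) = (p1, p2) -> RM (pmul L V, pmul V L) = (s1, s2) ->
  X = pmul c1 L - pmul L c2 ->
  Rform (pmul X U, pmul U X) (pmul L V, pmul V L) +
  Rform (pmul L U, pmul U L) (pmul X V, pmul V X) =
  (T3 p1 c1 (pmul L V) - T3 s1 c1 (pmul L U)) +
  (T3 c2 p2 (pmul V L) - T3 c2 s2 (pmul U L)) +
  (mixed L s1 c2 U + mixed L c1 s2 U) - (mixed L p1 c2 V + mixed L c1 p2 V).
Proof.
move=> RU RV ->; rewrite /Rform Rmatrix_skew// RU RV /pairing2/=.
have m1 : pairing (pmul (pmul c1 L - pmul L c2) U) s1 =
    T3 s1 c1 (pmul L U) - mixed L s1 c2 U.
  rewrite !pmulBl pairingBl /mixed; congr (_ - _).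
    by rewrite [RHS]Tr3C// /Tr3 /pairing -!pmulA.
  by rewrite /Tr3 /pairing -!pmulA// [RHS]TrC// -!pmulA.
have m2 : pairing (pmul U (pmul c1 L - pmul L c2)) s2 =
    mixed L c1 s2 U - T3 c2 s2 (pmul U L).
  rewrite !pmulBr pairingBl /mixed; congr (_ - _).
    by rewrite /pairing -!pmulA// [LHS]TrC// /Tr3 -!pmulA.
  by rewrite /pairing /Tr3 [RHS]TrC// -!pmulA.
have m3 : pairing p1 (pmul (pmul c1 L - pmul L c2) V) =
    T3 p1 c1 (pmul L V) - mixed L p1 c2 V.
  by rewrite !pmulBl pairingBr /mixed /pairing /Tr3 -!pmulA.
have m4 : pairing p2 (pmul V (pmul c1 L - pmul L c2)) =
    mixed L c1 p2 V - T3 c2 p2 (pmul V L).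
  rewrite !pmulBr pairingBr /mixed /pairing /Tr3; congr (_ - _).
    by rewrite pmulA// TrC// -!pmulA.
  by rewrite -!pmulA// [RHS]TrC// -!pmulA.
by rewrite m1 m2 m3 m4; ring.
Qed.

(** The mixed traces cancel in the cyclic sum; the others add up to the
    difference of [cybe] for the left and for the right gradients, whose right
    sides agree by cyclicity of the trace. *)
Lemma jacobi_first_order L U V Z :
  let Q U V X := Rform (pmul X U, pmul U X) (pmul L V, pmul V L) +
                 Rform (pmul L U, pmul U L) (pmul X V, pmul V X) in
  Q U V (hamfield L Z) + Q V Z (hamfield L U) + Q Z U (hamfield L V) = 0.
Proof.
move=> Q; rewrite /Q.
case RU : (RM (pmul L U, pmul U L)) => [p1 p2].
case RV : (RM (pmul L V, pmul V L)) => [s1 s2].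
case RZ : (RM (pmul L Z, pmul Z L)) => [c1 c2].
have hU : hamfield L U = pmul p1 L - pmul L p2 by rewrite /hamfield RU.
have hV : hamfield L V = pmul s1 L - pmul L s2 by rewrite /hamfield RV.
have hZ : hamfield L Z = pmul c1 L - pmul L c2 by rewrite /hamfield RZ.
rewrite (Rform_leibniz RU RV hZ) (Rform_leibniz RV RZ hU) (Rform_leibniz RZ RU hV).
have := cybe q0 (pmul L U) (pmul L V) (pmul L Z)
  (a (P0 (pmul L U)) + b (P0 (pmul U L)))
  (a (P0 (pmul L V)) + b (P0 (pmul V L)))
  (a (P0 (pmul L Z)) + b (P0 (pmul Z L))).
have := cybe q0 (pmul U L) (pmul V L) (pmul Z L)
  (c (P0 (pmul L U)) + d (P0 (pmul U L)))
  (c (P0 (pmul L V)) + d (P0 (pmul V L)))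
  (c (P0 (pmul L Z)) + d (P0 (pmul Z L))).
rewrite /=.
have := Rmatrix1E a b c d (pmul L U, pmul U L); rewrite RU /= => <-.
have := Rmatrix1E a b c d (pmul L V, pmul V L); rewrite RV /= => <-.
have := Rmatrix1E a b c d (pmul L Z, pmul Z L); rewrite RZ /= => <-.
have := Rmatrix2E a b c d (pmul L U, pmul U L); rewrite RU /= => <-.
have := Rmatrix2E a b c d (pmul L V, pmul V L); rewrite RV /= => <-.
have := Rmatrix2E a b c d (pmul L Z, pmul Z L); rewrite RZ /= => <-.
have rot A B D : T3 (pmul A L) (pmul B L) (pmul D L) =
    T3 (pmul L A) (pmul L B) (pmul L D).
  by rewrite /Tr3 -!pmulA// [RHS]TrC// -!pmulA.
rewrite (rot U V Z) (rot V U Z) => e2 e1.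
have /eqP := etrans e1 (esym e2); rewrite -subr_eq0 => /eqP e.
by rewrite -[RHS]oppr0 -e; ring.
Qed.

Lemma bracket_atl L U V : brk L U V = - pairing (hamfield L V) U.
Proof. by rewrite bracket_atC// hamfieldE. Qed.

(** Derivative of a bracket along the Hamiltonian field of a third functional:
    the terms with first derivatives of the gradients are values of the
    Hessians on Hamiltonian fields. *)
Lemma bracket_bracket E dE U dU V dV Z L :
  regular U dU -> regular V dV -> regular E dE ->
  grad q (fun L => Tr (E L)) L = Z ->
  br (fun L => Tr (bracket_op U V L)) (fun L => Tr (E L)) L =
  - (Rform (pmul (hamfield L Z) (U L), pmul (U L) (hamfield L Z))
           (pmul L (V L), pmul (V L) L) +
     Rform (pmul L (U L), pmul (U L) L)
           (pmul (hamfield L Z) (V L), pmul (V L) (hamfield L Z)) +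
     (pairing (dV L (hamfield L Z)) (hamfield L (U L)) -
      pairing (dU L (hamfield L Z)) (hamfield L (V L)))).
Proof.
move=> rU rV rE gE; have rB := regular_bracket_op rU rV.
have [W [dW [_ gW WE _]]] := regular_gradient q0 rB.
rewrite /bracket gW gE bracket_atl pairingC// -WE; congr (- _).
rewrite Tr_dbracket_op; congr (_ + _); rewrite bracket_atl hamfieldE addrC.
by congr (_ - _); rewrite pairingC.
Qed.

Lemma bracket_jacobi phi psi chi L :
  regular_functional q phi -> regular_functional q psi ->
  regular_functional q chi ->
  br (br phi psi) chi L + br (br psi chi) phi L + br (br chi phi) psi L = 0.
Proof.
move=> [E [dE [rE ->]]] [F [dF [rF ->]]] [G [dG [rG ->]]].
have [U [dU [rU gU _ sU]]] := regular_gradient q0 rE.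
have [V [dV [rV gV _ sV]]] := regular_gradient q0 rF.
have [Z [dZ [rZ gZ _ sZ]]] := regular_gradient q0 rG.
have brE E1 E2 U1 U2 : grad q (fun L => Tr (E1 L)) = U1 ->
    grad q (fun L => Tr (E2 L)) = U2 ->
    br (fun L => Tr (E1 L)) (fun L => Tr (E2 L)) =
    (fun L => Tr (bracket_op U1 U2 L)).
  by move=> g1 g2; apply/funext => M; rewrite Tr_bracket_op /bracket g1 g2.
rewrite (brE _ _ _ _ gU gV) (brE _ _ _ _ gV gZ) (brE _ _ _ _ gZ gU).
rewrite (bracket_bracket rU rV rG (Z := Z L)); last by rewrite gZ.
rewrite (bracket_bracket rV rZ rE (Z := U L)); last by rewrite gU.
rewrite (bracket_bracket rZ rU rF (Z := V L)); last by rewrite gV.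
have := jacobi_first_order L (U L) (V L) (Z L); rewrite /=.
rewrite (sU L (hamfield L (V L))) (sV L (hamfield L (Z L))).
rewrite (sZ L (hamfield L (U L))) => e.
by rewrite -[RHS]oppr0 -e; ring.
Qed.

Lemma regular_functional_curve phi L X : regular_functional q phi ->
  @pcurve R C^o (fun t : C => phi (L + t *: X)) (pairing (grad q phi L) X).
Proof.
move=> [E [dE [rE ->]]]; have [U [dU [rU -> UE _]]] := regular_gradient q0 rE.
by rewrite -UE; exact: (pcurve_lin (Tr_linear (R := R)) (regular_curve L X rE)).
Qed.

Lemma grad_affine (k : C) phi psi L :
  regular_functional q phi -> regular_functional q psi ->
  grad q (cst k \* phi \+ psi) L = k *: grad q phi L + grad q psi L.
Proof.
move=> rphi rpsi; apply: (gradE q0); apply: pcurve_gradient => X _.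
rewrite pairingDl pairingZl; apply: pcurveD; last exact: regular_functional_curve.
have lk : linear (fun x : C^o => k * x : C^o).
  by move=> l x y; rewrite mulrDr /GRing.scale/= mulrCA.
exact: (pcurve_lin lk (regular_functional_curve L X rphi)).
Qed.

Lemma grad_product phi psi L :
  regular_functional q phi -> regular_functional q psi ->
  grad q (phi \* psi) L = psi L *: grad q phi L + phi L *: grad q psi L.
Proof.
move=> rphi rpsi; apply: (gradE q0); apply: pcurve_gradient => X _.
have ml (x : C^o) : linear (fun y : C^o => (x : C) * y : C^o).
  by move=> l y z; rewrite mulrDr /GRing.scale/= mulrCA.
have mr (y : C^o) : linear (fun x : C^o => (x : C) * y : C^o).
  by move=> l x z; rewrite mulrDl /GRing.scale/= mulrA.
have := pcurve_bilin ml mr (regular_functional_curve L X rphi)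
  (regular_functional_curve L X rpsi).
move/pcurve_eq; apply => //.
by rewrite scale0r addr0 pairingDl !pairingZl mulrC.
Qed.

Lemma poisson_bracket_Rmatrix : poisson_bracket q br.
Proof.
exists (regular_functional q); split.
- by move=> phi; exact: regular_functional_smooth.
- exact: coordinate_regular.
split.
- exact: regular_functional_algebra.
- move=> _ _ [E [dE [rE ->]]] [F [dF [rF ->]]].
  have [U [dU [rU gU _ _]]] := regular_gradient q0 rE.
  have [V [dV [rV gV _ _]]] := regular_gradient q0 rF.
  exists (bracket_op U V), (dbracket_op U V dU dV).
  split; first exact: regular_bracket_op.
  by apply/funext => L; rewrite Tr_bracket_op /bracket gU gV.
- by move=> phi psi L _ _; rewrite /bracket bracket_atC.
- move=> k phi psi chi L rphi rpsi _; split; rewrite /bracket.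
    rewrite grad_affine// !bracket_atl pairingDr pairingZr; ring.
  rewrite grad_product// !bracket_atl pairingDr !pairingZr; ring.
- by move=> *; exact: bracket_jacobi.
Qed.

End PoissonAlgebra.

(** * Hamiltonian fields on M_n *)

Section Tangency.
Context {R : realType} (q : R[i]) (q0 : q != 0).
Local Notation C := R[i].
Local Notation PsiD := (PsiD R).
Local Notation pmul := (pmul q).
Local Notation pairing := (pairing q).
Context (a b c d : {linear laurent R -> laurent R}) (n : nat).
Hypotheses (ha : adjoint a (\- a)) (hd : adjoint d (\- d)) (hc : adjoint c b).
Implicit Types (L U V W X Y Z A B : PsiD) (f g : laurent R).
Local Notation hamfield := (hamfield q a b c d).

Definition tangent X : Prop :=
  (forall i : int, i < 0 -> X i = 0) /\ (forall i : int, n%:Z <= i -> X i = 0).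

Lemma Mn_line L X : Mn n L -> (forall t : C, Mn n (L + t *: X)) <-> tangent X.
Proof.
move=> [Ln Labove Lbelow]; split=> [H|[Xb Xa] t]; last first.
  split=> [|i ni|i i0]; rewrite lcoefD lcoefZ.
  - by rewrite Xa// scaler0 addr0.
  - by rewrite Xa ?scaler0 ?addr0 ?Labove// ltW.
  - by rewrite Xb// scaler0 addr0 Lbelow.
have [H1 H2 H3] := H 1; split=> i; last rewrite le_eqVlt => /predU1P[<-|].
- by move=> i0; have := H3 i i0; rewrite lcoefD lcoefZ Lbelow// add0r scale1r.
- by move: H1; rewrite lcoefD lcoefZ Ln scale1r => /(canRL (addKr _)); rewrite addNr.
- by move=> ni; have := H2 i ni; rewrite lcoefD lcoefZ Labove// add0r scale1r.
Qed.

Lemma Mn_above L : Mn n L -> vanishes_above L n%:Z.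
Proof. by case. Qed.
Lemma Mn_below L : Mn n L -> vanishes_below L 0.
Proof. by case. Qed.

Lemma rmap_above A : vanishes_above (rmap A - 2^-1 *: A) 0.
Proof.
move=> i i0; rewrite lcoefB /rmap !lcoefZ lcoefB !coef_trunc i0.
by rewrite ifF ?subr0 ?subrr//; apply/negbTE; rewrite -leNgt ltW.
Qed.

Lemma rmap_below A : vanishes_below (rmap A + 2^-1 *: A) 0.
Proof.
move=> i i0; rewrite lcoefD /rmap !lcoefZ lcoefB !coef_trunc i0.
by rewrite ifF ?sub0r ?scalerN ?addNr//; apply/negbTE; rewrite -leNgt ltW.
Qed.

Lemma rmap_P0 A : (rmap A) 0 = 0.
Proof. by rewrite /rmap lcoefZ lcoefB !coef_trunc ltxx subrr scaler0. Qed.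

(** Since (LU)L = L(UL), a multiple of LU and UL may be added to the two
    components.  With k = 1/2 both become differential operators, with k = -1/2
    both have order at most 0; this bounds the degrees of the field from both
    sides. *)
Lemma hamfield_shift k L U : hamfield L U =
  pmul (rmap (pmul L U) + k *: pmul L U
        + inJ0 (a (P0 (pmul L U)) + b (P0 (pmul U L)))) L -
  pmul L (rmap (pmul U L) + k *: pmul U L
          + inJ0 (c (P0 (pmul L U)) + d (P0 (pmul U L)))).
Proof.
rewrite /hamfield Rmatrix1E Rmatrix2E !pmulDl !pmulDr pmulZl pmulZr pmulA//.
move: (pmul (rmap _) L) (pmul (inJ0 _) L) (pmul L (rmap _)) (pmul L (inJ0 _)).
move: (k *: _) => s x y z t.
by rewrite (addrAC x s) (addrAC z s) (opprD (z + t)) (addrACA (x + y)) subrr addr0.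
Qed.

Lemma hamfield_below L U : Mn n L -> vanishes_below (hamfield L U) 0.
Proof.
move=> LM i i0; rewrite (hamfield_shift 2^-1) lcoefB.
have Lb := Mn_below LM.
have below A f : vanishes_below (rmap A + 2^-1 *: A + inJ0 f) 0.
  by move=> j j0; rewrite lcoefD rmap_below// inJ0_below// addr0.
rewrite (pmul_vanishes_below q (below _ _) Lb)// ?addr0//.
by rewrite (pmul_vanishes_below q Lb (below _ _)) ?subrr ?addr0.
Qed.

Lemma hamfield_above_aux A f :
  vanishes_above (rmap A + (- 2^-1) *: A + inJ0 f) 0.
Proof.
by move=> j j0; rewrite scaleNr lcoefD rmap_above// inJ0_above// addr0.
Qed.

Lemma hamfield_above L U : Mn n L -> vanishes_above (hamfield L U) n%:Z.
Proof.
move=> LM i ni; rewrite (hamfield_shift (- 2^-1)) lcoefB.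
have La := Mn_above LM.
rewrite (pmul_vanishes q (@hamfield_above_aux _ _) La) ?add0r//.
by rewrite (pmul_vanishes q La (@hamfield_above_aux _ _)) ?oppr0 ?addr0.
Qed.

Definition top_defect f g : laurent R :=
  (a f + b g - 2^-1 *: f) - hpow q n%:Z (c f + d g - 2^-1 *: g).

(** In the form of order at most 0 only the constant parts of the two components
    meet the leading coefficient of [L].  The other conditions of tangency hold
    for all a, b, c, d. *)
Lemma hamfield_top L U : Mn n L ->
  hamfield L U n%:Z = top_defect (P0 (pmul L U)) (P0 (pmul U L)).
Proof.
move=> LM; have La := Mn_above LM; have [Ln _ _] := LM.
rewrite (hamfield_shift (- 2^-1)) lcoefB.
rewrite -[in X in X - _](add0r n%:Z) (pmul_top q (@hamfield_above_aux _ _) La).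
rewrite -[in X in _ - X](addr0 n%:Z) (pmul_top q La (@hamfield_above_aux _ _)).
rewrite Ln hpow0 lmul1r lmul1l !lcoefD !rmap_P0 !add0r.
rewrite !lcoefZ !coef_mono !eqxx !scaleNr.
by rewrite [_ + (_ + _)]addrC [in X in _ - hpow _ _ X]addrC.
Qed.

Lemma hamfield_tangent L U : Mn n L ->
  (forall f g, residue f = residue g -> top_defect f g = 0) ->
  tangent (hamfield L U).
Proof.
move=> LM H; split=> [i i0|i]; first exact: hamfield_below.
rewrite le_eqVlt => /predU1P[<-|ni]; last exact: hamfield_above.
by rewrite hamfield_top// H//; exact: TrC.
Qed.

(** By skewness {phi, psi}(L) is minus the derivative of phi along the field of
    psi, which vanishes when that field is tangent and phi is constant. *)
Lemma poisson_submanifold_Mn :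
  (forall f g, residue f = residue g -> top_defect f g = 0) ->
  poisson_submanifold q (bracket q a b c d) (Mn n).
Proof.
move=> H phi psi sphi _ [k phik] L LM; rewrite /bracket bracket_atl//.
set X := hamfield L _.
have XT : tangent X by exact: hamfield_tangent.
have MX := (Mn_line X LM).2 XT.
have gphi : is_gradient q setT phi L (grad q phi L) by exact: smooth_grad.
have e1 := @derive_val _ _ _ _ _ _ _ (gphi X (fun=> I)).
have phiE : (fun t : C => phi (L + t *: X)) = cst k.
  by apply/funext => t; rewrite phik.
rewrite phiE derive_cst in e1.
by rewrite pairingC// -e1 oppr0.
Qed.

(** The coefficients of the D^n term of [L] are constant on M_n, and their
    brackets with a functional are, up to nonzero factors, the coefficients of
    the D^n term of its field. *)
Lemma top_defect_Mn L U : Mn n L ->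
  poisson_submanifold q (bracket q a b c d) (Mn n) ->
  top_defect (P0 (pmul L U)) (P0 (pmul U L)) = 0.
Proof.
move=> LM PS; rewrite -hamfield_top//; apply/lserP => j.
pose V := mono (- n%:Z) (zpow (- j)) : PsiD.
have Vcst : exists k, forall M, Mn n M -> pairing V M = k.
  exists (residue (lmul (zpow (- j)) (hpow q (- n%:Z) (zpow 0)))) => M [Mtop _ _].
  by rewrite /pairing /Tr /P0 pmul_monol sub0r opprK Mtop.
have := PS _ (pairing U) (smooth_linear q V) (smooth_linear q U) Vcst L LM.
rewrite /bracket !grad_linear// bracket_atl// => /eqP.
by rewrite oppr_eq0 pairing_monomial mulf_eq0 expfz_eq0 (negPf q0) andbF => /eqP.
Qed.

Lemma Pnonneg_rmap A : Pnonneg A = rmap A + 2^-1 *: A + 2^-1 *: inJ0 (P0 A).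
Proof.
apply/lserP => i; rewrite /rmap !(lcoefD, lcoefN, lcoefZ) !coef_trunc coef_mono.
have half2 (f : laurent R) : 2^-1 *: f + 2^-1 *: f = f.
  by rewrite -scalerDl -[RHS]scale1r; congr (_ *: _); field.
case: (ltgtP i 0) => [i0|i0|->].
- by rewrite sub0r scalerN addNr scaler0 addr0.
- by rewrite subr0 scaler0 addr0 half2.
- by rewrite subr0 scaler0 add0r half2.
Qed.

(** Here r W = W_(+) - W_0 / 2 - W / 2, and the last term drops out of the field
    because W = LU = UL commutes with L; besides the Lax field there remain only
    products of L with elements of J_0. *)
Lemma hamfield_lax L U W : pmul L U = W -> pmul U L = W ->
  hamfield L U = commutator q (Pnonneg W) L
    + pmul (inJ0 (a (P0 W) + b (P0 W) - 2^-1 *: P0 W)) L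
    - pmul L (inJ0 (c (P0 W) + d (P0 W) - 2^-1 *: P0 W)).
Proof.
move=> LU UL; rewrite (hamfield_shift 2^-1) LU UL /commutator Pnonneg_rmap.
have inJ0B f : inJ0 (f - 2^-1 *: P0 W) = inJ0 f - 2^-1 *: inJ0 (P0 W) :> PsiD.
  by rewrite inJ0D; congr (_ + _); apply/lserP => i; rewrite lcoefN lcoefZ
    !coef_mono; case: ifP; rewrite ?scaler0 ?oppr0.
rewrite !inJ0B !pmulDl !pmulDr !pmulNl !pmulNr.
move: (pmul _ _) (pmul (2^-1 *: _) _) (pmul (inJ0 _) _) (pmul L _) (pmul L _)
  (pmul L (inJ0 _)) (pmul _ L) (pmul L _) => *.
by apply/lserP => i; apply/lserP => j; rewrite !(lcoefD, lcoefN); ring.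
Qed.

End Tangency.

(** * Inverses and roots *)

(** An equation [X = Phi X] in which each coefficient of [Phi X] only involves
    coefficients of [X] of higher degree is solved coefficient by coefficient
    from the top. *)
Lemma causal_fixpoint (R : realType) (Phi : PsiD R -> PsiD R) (N : int) :
  (forall X : PsiD R, vanishes_above X N -> vanishes_above (Phi X) N) ->
  (forall (X Y : PsiD R) k, vanishes_above X N -> vanishes_above Y N ->
     (forall i, k < i -> X i = Y i) -> Phi X k = Phi Y k) ->
  exists X : PsiD R, Phi X = X /\ vanishes_above X N.
Proof.
move=> PhiN causal; pose x m := iter m Phi (0 : PsiD R).
have xN m : vanishes_above (x m) N.
  by elim: m => [|m IH]; [move=> i _|rewrite /x iterS; exact: PhiN].
have stable m r i : N - m%:Z < i -> x (m + r)%N i = x m i.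
  elim: m r i => [|m IH] r i Nmi.
    by rewrite !xN//; lia.
  rewrite addSn /x !iterS; apply: causal; [exact: xN|exact: xN|].
  by move=> j ij; apply: IH; lia.
(* After [s i] iterations from 0 the coefficient of degree [i] is final. *)
pose s i := (absz (N - i)).+1.
have bx : bounded_above (fun i => x (s i) i) by exists N => i /xN.
pose X : PsiD R := lser_of bx.
have XN : vanishes_above X N by move=> i Ni; exact: xN.
exists X; split=> //; apply/lserP => i.
case: (ltP N i) => [Ni|iN]; first by rewrite (PhiN _ XN)// XN.
rewrite (causal _ (x (s i)) i XN (xN _)); last first.
  move=> j ij; rewrite -[X j]/(x (s j) j); case: (ltP N j) => [Nj|jN]; first by rewrite !xN.
  have -> : s i = (s j + (s i - s j))%N by rewrite /s; lia.
  by rewrite stable// /s; lia.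
rewrite -[Phi (x (s i))]/(x (s i).+1) -addn1 stable//.
by rewrite /s; lia.
Qed.

Section CausalEquations.
Context {R : realType} (q : R[i]) (q0 : q != 0).
Local Notation C := R[i].
Local Notation PsiD := (PsiD R).
Local Notation pmul := (pmul q).
Local Notation ppow := (ppow q).
Implicit Types (A B L P U V W X Y Z : PsiD) (f g w : laurent R).

Lemma pmul_eql A B B' N k : vanishes_above A N ->
  (forall j, k - N <= j -> B j = B' j) -> pmul A B k = pmul A B' k.
Proof.
move=> AN BB'; apply: eq_fsbigr => i _.
by case: (ltP N i) => [Ni|iN]; [rewrite AN// !lmul0l|rewrite BB'//; lia].
Qed.

Lemma pmul_eqr A A' B M k : vanishes_above B M ->
  (forall i, k - M <= i -> A i = A' i) -> pmul A B k = pmul A' B k.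
Proof.
move=> BM AA'; apply: eq_fsbigr => i _.
case: (leP (k - M) i) => [kMi|ikM]; first by rewrite AA'.
by rewrite BM ?linear0 ?lmul0r//; lia.
Qed.

Lemma monomM (i : int) : pmul (mono i (zpow 0)) (mono (- i) (zpow 0)) = pid.
Proof.
apply/lserP => k; rewrite pmul_monol lmul1l !coef_mono.
have -> : (k - i == - i) = (k == 0) by apply/eqP/eqP; lia.
by case: ifP; rewrite ?linear0 ?hpow_zpow0.
Qed.

Lemma monic_inverse L (N : int) : vanishes_above L N -> L N = zpow 0 ->
  exists Q, pmul L Q = pid /\ pmul Q L = pid.
Proof.
move=> LN L1; pose L' : PsiD := L - mono N (zpow 0).
have LE : L = mono N (zpow 0) + L' by rewrite /L' addrC subrK.
have L'N : vanishes_above L' (N - 1).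
  move=> i; rewrite /L' lcoefB coef_mono; case: (eqVneq i N) => [->|iN] Ni.
    by rewrite L1 subrr.
  by rewrite LN ?subrr//; lia.
clearbody L'.
have pidN : vanishes_above (pid : PsiD) 0 by exact: inJ0_above.
have monN (i : int) : vanishes_above (mono i (zpow 0) : PsiD) i.
  by move=> j ij; rewrite coef_mono ifF//; apply/eqP; lia.
have subN A B M : vanishes_above A M -> vanishes_above B M ->
    vanishes_above (A - B) M.
  by move=> AM BM i Mi; rewrite lcoefB AM// BM// subrr.
have weaken A (M M' : int) : M <= M' -> vanishes_above A M -> vanishes_above A M'.
  by move=> MM' AM i M'i; apply: AM; lia.
have [X [XE _]] : exists X, pmul (mono (- N) (zpow 0)) (pid - pmul L' X) = X /\
    vanishes_above X (- N).
  apply: causal_fixpoint => [X XN|X Y k _ _ XY].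
    rewrite -[X in vanishes_above _ X]addr0; apply: pmul_vanishes => //; apply: subN => //.
    by apply: weaken (pmul_vanishes q L'N XN); lia.
  rewrite !pmul_monol !lcoefB; congr (lmul _ (hpow _ _ (_ - _))).
  by apply: (pmul_eql L'N) => j kj; apply: XY; lia.
have [Y [YE _]] : exists Y, pmul (pid - pmul Y L') (mono (- N) (zpow 0)) = Y /\
    vanishes_above Y (- N).
  apply: causal_fixpoint => [Y YN|Y Z k _ _ YZ].
    rewrite -[X in vanishes_above _ X]add0r; apply: pmul_vanishes => //; apply: subN => //.
    by apply: weaken (pmul_vanishes q YN L'N); lia.
  have coefE M := pmul_monor q (- N) (zpow 0) (pid - pmul M L') k.
  apply: etrans (coefE Y) (etrans _ (esym (coefE Z))).
  apply: (congr1 (fun w => lmul w _)); rewrite lcoefB [RHS]lcoefB.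
  apply: (congr1 (fun w => _ - w)).
  by apply: (pmul_eqr L'N) => j kj; apply: YZ; lia.
have LX : pmul L X = pid.
  by rewrite LE pmulDl -{1}XE pmulA// monomM pmul1l subrK.
have YL : pmul Y L = pid.
  rewrite LE pmulDr -{1}YE -pmulA// -{2}[N]opprK monomM pmul1r.
  by rewrite subrK.
have XY : X = Y by rewrite -[X](pmul1l q) -YL -pmulA// LX pmul1r.
by exists X; split=> //; rewrite XY.
Qed.

Lemma ppowS A m : ppow A m.+1 = pmul A (ppow A m). Proof. by []. Qed.

Lemma ppowD A m k : ppow A (m + k) = pmul (ppow A m) (ppow A k).
Proof.
by elim: m => [|m IH]; rewrite ?pmul1l// addSn !ppowS IH pmulA.
Qed.

Lemma ppowC A Z m : pmul Z A = pmul A Z -> pmul Z (ppow A m) = pmul (ppow A m) Z.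
Proof.
move=> ZA; elim: m => [|m IH]; first by rewrite pmul1l pmul1r.
by rewrite ppowS pmulA// ZA -pmulA// IH pmulA.
Qed.

Definition monic1 A := A 1 = zpow 0 /\ vanishes_above A 1.

Lemma ppow_monic A m : monic1 A ->
  vanishes_above (ppow A m) m%:Z /\ ppow A m m%:Z = zpow 0.
Proof.
move=> [A1 Aa]; elim: m => [|m [IHa IH1]]; first by split=> //; exact: inJ0_above.
rewrite ppowS -addn1 PoszD addrC; split; first exact: pmul_vanishes.
by rewrite (pmul_top q Aa IHa) IH1 A1 lmul1l hpow_zpow0.
Qed.

Definition hsum (m : nat) w : laurent R := \sum_(j < m) hpow q j%:Z w.

(** The linearization of the power map: a change of one coefficient of a monic
    operator changes the power by the operator 1 + h + ... + h^(m-1). *)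
Lemma ppow_diff A B (k : int) m : monic1 A -> monic1 B ->
  (forall i, k < i -> A i = B i) ->
  vanishes_above (ppow A m - ppow B m) (m%:Z - 1 + k) /\
  (ppow A m - ppow B m) (m%:Z - 1 + k) = hsum m (A k - B k).
Proof.
move=> mA mB AB; have [B1 Ba] := mB.
elim: m => [|m [IHa IH1]].
  by rewrite subrr /hsum big_ord0; split.
have dE : ppow A m.+1 - ppow B m.+1 =
    pmul (A - B) (ppow A m) + pmul B (ppow A m - ppow B m).
  by rewrite !ppowS pmulBl pmulBr addrA subrK.
have dA : vanishes_above (A - B) k by move=> i ki; rewrite lcoefB AB// subrr.
have [Aa A1] := ppow_monic m mA.
have t1 := pmul_top q dA Aa; have t2 := pmul_top q Ba IHa.
have v1 := pmul_vanishes q dA Aa; have v2 := pmul_vanishes q Ba IHa.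
have e1 : k + m%:Z = m.+1%:Z - 1 + k by lia.
have e2 : 1 + (m%:Z - 1 + k) = m.+1%:Z - 1 + k by lia.
rewrite e1 in t1 v1; rewrite e2 in t2 v2; rewrite dE; split.
  by move=> i ki; rewrite lcoefD v1// v2// addr0.
rewrite lcoefD t1 t2 A1 B1 hpow_zpow0 lmul1r lmul1l IH1 /hsum big_ord_recl hpow0.
rewrite lcoefB; congr (_ + _); rewrite linear_sum; apply: eq_bigr => j _ /=.
by rewrite hpowD.
Qed.

End CausalEquations.

Section Roots.
Context {R : realType} (q : R[i]) (q0 : q != 0).
Hypothesis q_nonroot : forall k : int, k != 0 -> q ^ k != 1.
Local Notation C := R[i].
Local Notation PsiD := (PsiD R).
Local Notation pmul := (pmul q).
Local Notation ppow := (ppow q).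
Context (n : nat) (n0 : (0 < n)%N).
Implicit Types (A B L P U V W X Y Z : PsiD) (f g w : laurent R).

(* The eigenvalue of 1 + h + ... + h^(n-1) on z^k; since q is not a root of
   unity, none of them vanishes. *)
Definition hsum_eigen (k : int) : C := \sum_(j < n) q ^ (j%:Z * k).

Lemma hsum_eigen_neq0 k : hsum_eigen k != 0.
Proof.
rewrite /hsum_eigen; case: (eqVneq k 0) => [->|k0].
  under eq_bigr do rewrite mulr0 expr0z.
  by rewrite sumr_const card_ord pnatr_eq0 -lt0n.
have : (q ^ k) ^+ n - 1 != 0.
  rewrite subr_eq0 exprnP exprz_exp; apply: q_nonroot.
  by rewrite mulf_neq0// -lt0n.
rewrite subrX1 mulf_eq0 negb_or => /andP[_].
congr (_ != 0); apply: eq_bigr => j _.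
by rewrite exprnP exprz_exp mulrC.
Qed.

Lemma coef_hsum w k : hsum q n w k = hsum_eigen k * w k.
Proof. by rewrite /hsum lcoef_sum mulr_suml. Qed.

Definition hsum_inv : laurent R -> laurent R := diag (fun k => (hsum_eigen k)^-1).

Lemma hsumK w : hsum_inv (hsum q n w) = w.
Proof.
apply/lserP => k.
by rewrite /hsum_inv coef_diag coef_hsum mulKf// hsum_eigen_neq0.
Qed.

Lemma hsum_invK w : hsum q n (hsum_inv w) = w.
Proof.
apply/lserP => k.
by rewrite coef_hsum /hsum_inv coef_diag mulVKf// hsum_eigen_neq0.
Qed.

Lemma hsum_invB u v : hsum_inv (u - v) = hsum_inv u - hsum_inv v.
Proof. by rewrite /hsum_inv linearB. Qed.

Lemma hsum0 : hsum q n 0 = 0.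
Proof. by rewrite /hsum big1// => j _; rewrite linear0. Qed.

Lemma is_root_monic L P : is_root q n L P -> monic1 P.
Proof. by case. Qed.

(** By [ppow_diff] the Newton correction below, which divides the error of the
    n-th power by its linearization, is causal in the coefficients of [X]. *)
Lemma root_exists L : vanishes_above L n%:Z -> L n%:Z = zpow 0 ->
  exists P, is_root q n L P.
Proof.
move=> La L1.
pose P X : PsiD := mono 1 (zpow 0) + trunc (fun i => i <= 0) X.
have PX X i : i <= 0 -> P X i = X i.
  by move=> i0; rewrite lcoefD coef_trunc i0 coef_mono ifF ?add0r//; apply/eqP; lia.
have mP X : monic1 (P X).
  split=> [|i i1]; rewrite lcoefD coef_trunc coef_mono ?addr0//.
  by rewrite !ifF ?addr0//; [lia|apply/eqP; lia].
have bPhi X : bounded_above (fun k : int => if k <= 0 then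
    X k + hsum_inv (L (n%:Z - 1 + k) - ppow (P X) n (n%:Z - 1 + k)) else 0).
  by exists 0 => k k0; rewrite ifF//; lia.
have [|X Y k _ _ XY|X [XE _]] :=
    @causal_fixpoint R (fun X => lser_of (bPhi X) : PsiD) 0.
- by move=> X _ k k0 /=; rewrite ifF//; lia.
- rewrite /=; case: ifP => // k0.
  have PXY i : k < i -> P X i = P Y i.
    move=> ki; rewrite !lcoefD !coef_trunc; congr (_ + _).
    by case: ifP => // _; exact: XY.
  have [_] := ppow_diff q0 n (mP X) (mP Y) PXY.
  rewrite !PX// lcoefB => /(congr1 hsum_inv); rewrite hsumK.
  move: (ppow (P X) n _) (ppow (P Y) n _) (L _) => u v l e.
  have -> : l - u = (l - v) - (u - v) by rewrite opprB addrA subrK.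
  rewrite hsum_invB e opprB addrCA addrC.
  by rewrite [X k + _]addrC subrK.
exists (P X); have [P1 Pa] := mP X; split=> //.
have [Pna Pn1] := ppow_monic q n (mP X).
apply/lserP => i; case: (ltgtP i n%:Z) => [i_n|i_n|->].
- have k0 : i - n%:Z + 1 <= 0 by lia.
  have := congr1 (fun A : PsiD => A (i - n%:Z + 1)) XE; rewrite /= k0.
  rewrite -[X in _ = X]addr0 => /addrI.
  have -> : n%:Z - 1 + (i - n%:Z + 1) = i by lia.
  move=> /(congr1 (hsum q n)); rewrite hsum_invK hsum0 => /eqP.
  by rewrite subr_eq0 => /eqP.
- by rewrite Pna// La.
- by rewrite Pn1 L1.
Qed.

Lemma rootP L : Mn n L -> is_root q n L (Defs.root q n L).
Proof.
by move=> [L1 La _]; apply: xgetPex; exact: root_exists.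
Qed.

End Roots.

(** * Gradients of the fractional traces *)

Section CoefficientwiseCurves.
Context {R : realType} (q : R[i]) (q0 : q != 0).
Local Notation C := R[i].
Local Notation PsiD := (PsiD R).
Local Notation pmul := (pmul q).
Local Notation ppow := (ppow q).
Implicit Types (L P U V W X Y Z : PsiD) (A B : C -> PsiD).

(** Roots depend on the operator through a series that is polynomial in each
    coefficient separately, with unbounded degrees; hence the coefficientwise
    version of [pcurve], with a common bound on the orders. *)
Definition ccurve A (DA : PsiD) (N : int) :=
  (forall i, N < i -> (forall t, A t i = 0) /\ DA i = 0) /\
  (forall i, pcurve (fun t => A t i) (DA i)).

Lemma ccurve_exists A N : (forall t, vanishes_above (A t) N) ->
  (forall i, exists v, pcurve (fun t => A t i) v) -> exists DA, ccurve A DA N.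
Proof.
move=> AN /choice[v Av].
have bA : bounded_above (fun i => if N < i then 0 else v i).
  by exists N => i ->.
exists (lser_of bA); split=> [i Ni|i] /=; first by rewrite Ni; split=> // t; exact: AN.
case: ifP => // Ni; apply: pcurve_eq (pcurve_cst (0 : laurent R)) _ _ => // t.
exact: AN.
Qed.

Let twistl_linear (i : int) (y : laurent R) : linear (fun x => lmul x (hpow q i y)).
Proof. by move=> k x z; rewrite lmulDl lmulZl. Qed.
Let twistr_linear (i : int) (x : laurent R) : linear (fun y => lmul x (hpow q i y)).
Proof. by move=> k y z; rewrite linearP lmulDr lmulZr. Qed.

Let twist_biadd i : biadditive (fun x y : laurent R => lmul x (hpow q i y)).
Proof. by split=> x y z; rewrite ?linearD ?lmulDl ?lmulDr. Qed.

Lemma ccurve_mul A DA B DB N M : ccurve A DA N -> ccurve B DB M ->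
  ccurve (fun t => pmul (A t) (B t)) (pmul DA (B 0) + pmul (A 0) DB) (N + M).
Proof.
move=> [AN Ac] [BM Bc].
have AN0 t : vanishes_above (A t) N by move=> i /AN[].
have BM0 t : vanishes_above (B t) M by move=> i /BM[].
have DAN : vanishes_above DA N by move=> i /AN[].
have DBM : vanishes_above DB M by move=> i /BM[].
split=> [k NMk|k].
  split=> [t|]; first exact: (pmul_vanishes q (AN0 t) (BM0 t)).
  by rewrite lcoefD (pmul_vanishes q DAN (BM0 0))// (pmul_vanishes q (AN0 0) DBM)// addr0.
have w U V : vanishes_above U N -> vanishes_above V M -> pmul U V k =
    \sum_(i <- window (k - M) N) lmul (U i) (hpow q i (V (k - i))).
  by move=> UN VM; rewrite pmulE (@cprod_window _ _ _ _ _ _ N M _ (k - M) N).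
have H i := pcurve_bilin (twistr_linear i) (twistl_linear i) (Ac i) (Bc (k - i)).
apply: pcurve_eq (pcurve_sum (window (k - M) N) H) _ _ => [t|]; first by rewrite w.
by rewrite lcoefD !w// -big_split.
Qed.

Fixpoint dppow (P P' : PsiD) (m : nat) : PsiD :=
  if m is m'.+1 then pmul P' (ppow P m') + pmul P (dppow P P' m') else 0.

Lemma ccurve_ppow A DA m : ccurve A DA 1 ->
  ccurve (fun t => ppow (A t) m) (dppow (A 0) DA m) m%:Z.
Proof.
move=> Ac; elim: m => [|m IH].
  split=> i; last exact: pcurve_cst.
  by move=> i0; split=> // t; exact: inJ0_above.
have := ccurve_mul Ac IH.
by have -> : 1 + m%:Z = m.+1%:Z by lia.
Qed.

(** Under a trace the factors of the derivative of a power can be collected, even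
    in the presence of a factor that commutes with the base. *)
Lemma Tr_dppow Z P P' m : pmul Z P = pmul P Z ->
  Tr (pmul Z (dppow P P' m)) = m%:R * Tr (pmul Z (pmul (ppow P m.-1) P')).
Proof.
elim: m Z => [|m IH] Z ZP; first by rewrite /= pmul0r mul0r.
have ZPP : pmul (pmul Z P) P = pmul P (pmul Z P) by rewrite pmulA// ZP.
rewrite [dppow _ _ _]/= pmulDr TrD [X in _ + Tr X](pmulA q0) (IH _ ZPP).
have -> : Tr (pmul Z (pmul P' (ppow P m))) = Tr (pmul Z (pmul (ppow P m) P')).
  by rewrite (pmulA q0 Z P') (TrC q0) (pmulA q0) -(ppowC q0 m ZP) -(pmulA q0).
rewrite -addn1 natrD mulrDl mul1r addrC addn1; congr (_ + _).
case: m {IH} => [|m]; first by rewrite !mul0r.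
by rewrite -(pmulA q0 Z P) (pmulA q0 P).
Qed.

Lemma pcurve_laurent_unique (f : C -> laurent R) v w :
  pcurve f v -> pcurve f w -> v = w.
Proof.
move=> fv fw; apply/lserP => j.
have lj : linear (fun x : laurent R => x j : C^o) by [].
exact: (pcurve_unique (pcurve_lin lj fv) (pcurve_lin lj fw)).
Qed.

End CoefficientwiseCurves.

Section HamiltonianGradients.
Context {R : realType} (q : R[i]) (q0 : q != 0).
Hypothesis q_nonroot : forall k : int, k != 0 -> q ^ k != 1.
Local Notation C := R[i].
Local Notation PsiD := (PsiD R).
Local Notation pmul := (pmul q).
Local Notation ppow := (ppow q).
Context (n : nat) (n0 : (0 < n)%N).
Implicit Types (L P U V W X Y Z : PsiD).

(** This recursion expresses a coefficient of the root through those of higher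
    degree; it carries polynomial dependence on a parameter from [L] to [P]. *)
Lemma root_coef L P (k : int) : is_root q n L P -> k <= 0 ->
  P k = hsum_inv q n
    (L (n%:Z - 1 + k) - ppow (trunc (fun i => k < i) P) n (n%:Z - 1 + k)).
Proof.
move=> rP k0; have mP := is_root_monic rP; have [P1 Pa] := mP.
have mT : monic1 (trunc (fun i => k < i) P).
  split=> [|i i1]; rewrite coef_trunc; first by rewrite ifT//; lia.
  by rewrite Pa// if_same.
have PT i : k < i -> P i = trunc (fun i => k < i) P i by rewrite coef_trunc => ->.
have [_] := ppow_diff q0 n mP mT PT; rewrite lcoefB coef_trunc ltxx subr0.
by case: rP => _ _ -> ->; rewrite hsumK.
Qed.

Lemma root_curve L X : Mn n L -> tangent n X ->
  exists P', ccurve (fun t : C => Defs.root q n (L + t *: X)) P' 1.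
Proof.
move=> LM XT; have LX := (Mn_line X LM).2 XT.
pose P t := Defs.root q n (L + t *: X).
have rP t : is_root q n (L + t *: X) (P t) by exact: rootP.
have Pa t : vanishes_above (P t) 1 by case: (rP t).
apply: ccurve_exists => //.
suff H (m : nat) i : 1 - m%:Z < i -> exists v, pcurve (fun t => P t i) v.
  by move=> i; apply: (H (absz (2 - i))); lia.
elim: m i => [|m IH] i mi.
  exists 0; apply: pcurve_eq (pcurve_cst (0 : laurent R)) _ _ => // t.
  by rewrite Pa//; lia.
case: (ltP 0 i) => [i0|i0].
  case: (eqVneq i 1) => [->|i1].
    exists 0; apply: pcurve_eq (pcurve_cst (zpow 0)) _ _ => // t.
    by case: (rP t).
  exists 0; apply: pcurve_eq (pcurve_cst (0 : laurent R)) _ _ => // t.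
  by rewrite Pa//; lia.
have [|j|T' Tc] := @ccurve_exists R (fun t => trunc (fun j => i < j) (P t)) 1.
- by move=> t j j1; rewrite coef_trunc Pa// if_same.
- case: (ltP i j) => ij; last first.
    exists 0; apply: pcurve_eq (pcurve_cst (0 : laurent R)) _ _ => // t.
    by rewrite coef_trunc ltNge ij.
  have [|v Hv] := IH j; first by lia.
  by exists v; apply: pcurve_eq Hv _ _ => // t; rewrite coef_trunc ij.
have [_ Tn] := ccurve_ppow q0 n Tc.
pose idx := n%:Z - 1 + i.
have Lc : pcurve (fun t : C => (L + t *: X) idx) (X idx) by exact: pcurve_line.
have lin : linear (fun x : laurent R => -1 *: x).
  by move=> k x y; rewrite scalerDr !scalerA mulrC.
have H := pcurve_lin (diag_linear (fun k => (hsum_eigen q n k)^-1))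
  (pcurveD Lc (pcurve_lin lin (Tn idx))).
exists (hsum_inv q n (X idx + -1 *: dppow q (trunc (fun j => i < j) (P 0)) T' n idx)).
apply: (pcurve_eq H) => // t.
by rewrite (root_coef (rP t) i0) scaleN1r.
Qed.

(** Let P be the root, P' its derivative along X, U = L^-1 P^m.  Since X is the
    derivative of P^n, <U, X> = n Tr (U P^(n-1) P') = n Tr (P^(m-1) P'), which
    is the derivative of n/m Tr P^m. *)
Lemma hamiltonian_gradient m L : (0 < m)%N -> Mn n L ->
  exists U, [/\ is_gradient q (Mn n) (hamiltonian q n m) L U,
    pmul L U = fracpow q n m L & pmul U L = fracpow q n m L].
Proof.
move=> m0 LM; have [L1 La _] := LM.
have [Q [LQ QL]] := monic_inverse q0 La L1.
pose P := Defs.root q n L; have [P1 Pa Pn] : is_root q n L P by exact: rootP.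
have PC k : pmul (ppow P k) P = pmul P (ppow P k) by rewrite (ppowC q0 k).
have PL : pmul P L = pmul L P by rewrite -Pn PC.
have QP : pmul Q P = pmul P Q.
  by rewrite -[LHS](pmul1r q) -LQ (pmulA q0 (pmul Q P)) -(pmulA q0 Q P) PL
    (pmulA q0 Q L) QL pmul1l.
pose U := pmul Q (ppow P m); exists U.
have LU : pmul L U = ppow P m by rewrite pmulA// LQ pmul1l.
have UL : pmul U L = ppow P m.
  by rewrite /U -pmulA// -(ppowC q0 m (esym PL)) pmulA// QL pmul1l.
split=> //.
have UP : pmul U P = pmul P U by rewrite /U -pmulA// PC pmulA// QP pmulA.
have UPn : pmul U (ppow P n.-1) = ppow P m.-1.
  rewrite /U -pmulA// -ppowD//.
  have -> : (m + n.-1 = n + m.-1)%N by rewrite -!subn1; lia.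
  by rewrite ppowD// Pn pmulA// QL pmul1l.
apply: pcurve_gradient => X LX; have XT := (Mn_line X LM).1 LX.
have [P' Pc] := root_curve LM XT.
have root0 : Defs.root q n (L + 0 *: X) = P by rewrite scale0r addr0.
have [_ Pnc] := ccurve_ppow q0 n Pc; have [_ Pmc] := ccurve_ppow q0 m Pc.
rewrite root0 in Pnc Pmc.
have XE : X = dppow q P P' n.
  apply/lserP => i; apply: (pcurve_laurent_unique _ (Pnc i)).
  apply: pcurve_eq (pcurve_line (L i) (X i)) _ _ => // t.
  by have [_ _ ->] := rootP q0 q_nonroot n0 (LX t).
have lres : linear (fun x : laurent R => n%:R / m%:R * residue x : C^o).
  by move=> k x y; rewrite residueD residueZ mulrDr mulrCA.
apply: pcurve_eq (pcurve_lin lres (Pmc 0)) _ _ => [t|]; first by [].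
rewrite -[residue _]/(Tr (dppow q P P' m)) XE /pairing Tr_dppow//.
have := @Tr_dppow _ _ q0 pid P P' m; rewrite !pmul1l pmul1r => -> //.
rewrite pmulA// UPn mulrA mulfVK// pnatr_eq0 -lt0n//.
Qed.

End HamiltonianGradients.

(** * Existence *)

Section Existence.
Context {R : realType} (q : R[i]) (q0 : q != 0).
Hypothesis q_nonroot : forall k : int, k != 0 -> q ^ k != 1.
Local Notation C := R[i].
Local Notation PsiD := (PsiD R).
Local Notation pmul := (pmul q).
Local Notation pairing := (pairing q).
Context (n : nat) (n0 : (0 < n)%N).
Implicit Types (L P U V W X Y Z : PsiD) (f g w : laurent R).

(** The Gelfand-Dickey operators, as the theorem displays them. *)
Definition gd_a f : laurent R := 2^-1 *: ratP0' q n (fun x => (1 + x) / (1 - x)) f.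
Definition gd_b f : laurent R := - ratP0' q n (fun x => x / (1 - x)) f + 2^-1 *: P00 f.
Definition gd_c f : laurent R := ratP0' q n (fun x => (1 - x)^-1) f + 2^-1 *: P00 f.
Definition gd_d f : laurent R := - (2^-1 *: ratP0' q n (fun x => (1 + x) / (1 - x)) f).

(* The four operators are diagonal in the basis z^k, so that every identity
   between them is one between rational functions of q^(nk). *)
Definition multiplier_a (k : int) : C :=
  if k == 0 then 0 else 2^-1 * ((1 + q ^ (n%:Z * k)) / (1 - q ^ (n%:Z * k))).
Definition multiplier_b (k : int) : C :=
  if k == 0 then 2^-1 else - (q ^ (n%:Z * k) / (1 - q ^ (n%:Z * k))).
Definition multiplier_c (k : int) : C :=
  if k == 0 then 2^-1 else (1 - q ^ (n%:Z * k))^-1.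
Definition multiplier_d (k : int) : C := - multiplier_a k.

Lemma coef_P00 f (k : int) : P00 f k = if k == 0 then f k else 0.
Proof.
rewrite /P00 laurentZ coef_mono /residue.
by case: eqVneq => [->|_]; rewrite ?mulr1 ?mulr0.
Qed.

Lemma gd_aE f : gd_a f = diag multiplier_a f.
Proof.
apply/lserP => k; rewrite /gd_a laurentZ !coef_diag /multiplier_a.
by case: ifP; rewrite ?mul0r ?mulr0 ?mulrA.
Qed.

Lemma gd_bE f : gd_b f = diag multiplier_b f.
Proof.
apply/lserP => k; rewrite /gd_b lcoefD lcoefN laurentZ coef_P00 !coef_diag.
rewrite /multiplier_b; case: ifP => _; first by rewrite mul0r oppr0 add0r.
by rewrite mulr0 addr0 mulNr.
Qed.

Lemma gd_cE f : gd_c f = diag multiplier_c f.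
Proof.
apply/lserP => k; rewrite /gd_c lcoefD laurentZ coef_P00 !coef_diag.
rewrite /multiplier_c; case: ifP => _; first by rewrite mul0r add0r.
by rewrite mulr0 addr0.
Qed.

Lemma gd_dE f : gd_d f = diag multiplier_d f.
Proof.
by apply/lserP => k; rewrite /gd_d -/(gd_a f) gd_aE lcoefN !coef_diag mulNr.
Qed.

Lemma gd_a_linear : linear gd_a.
Proof. by move=> k f g; rewrite !gd_aE linearP. Qed.
Lemma gd_b_linear : linear gd_b.
Proof. by move=> k f g; rewrite !gd_bE linearP. Qed.
Lemma gd_c_linear : linear gd_c.
Proof. by move=> k f g; rewrite !gd_cE linearP. Qed.
Lemma gd_d_linear : linear gd_d.
Proof. by move=> k f g; rewrite !gd_dE linearP. Qed.

HB.instance Definition _ :=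
  GRing.isLinear.Build C (laurent R) (laurent R) *:%R gd_a gd_a_linear.
HB.instance Definition _ :=
  GRing.isLinear.Build C (laurent R) (laurent R) *:%R gd_b gd_b_linear.
HB.instance Definition _ :=
  GRing.isLinear.Build C (laurent R) (laurent R) *:%R gd_c gd_c_linear.
HB.instance Definition _ :=
  GRing.isLinear.Build C (laurent R) (laurent R) *:%R gd_d gd_d_linear.

Lemma diag_adjoint (s t : int -> C) : (forall k, t k = s (- k)) ->
  forall f g, residue (lmul (diag s f) g) = residue (lmul f (diag t g)).
Proof.
move=> ts f g; rewrite /residue !lmulE; apply: eq_fsbigr => i _.
by rewrite !coef_diag ts sub0r opprK mulrCA mulrA.
Qed.

Lemma one_minus_q (k : int) : k != 0 -> 1 - q ^ (n%:Z * k) != 0.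
Proof.
move=> k0; rewrite subr_eq0 eq_sym; apply: q_nonroot.
by rewrite mulf_neq0// -lt0n.
Qed.

Lemma multiplier_opp (k : int) : k != 0 ->
  let x := q ^ (n%:Z * k) in [/\ x != 0, 1 - x != 0 & q ^ (n%:Z * - k) = x^-1].
Proof.
by move=> k0; split; [exact: expfz_neq0|exact: one_minus_q|rewrite mulrN invr_expz].
Qed.

Lemma multiplier_aN k : multiplier_a (- k) = - multiplier_a k.
Proof.
rewrite /multiplier_a oppr_eq0; case: (eqVneq k 0) => [_|k0]; first by rewrite oppr0.
have [x0 x1 ->] := multiplier_opp k0.
have x2 : q ^ (n%:Z * k) - 1 != 0 by rewrite -opprB oppr_eq0.
by field; rewrite x0 x1 x2.
Qed.

Lemma multiplier_bN k : multiplier_b (- k) = multiplier_c k.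
Proof.
rewrite /multiplier_b /multiplier_c oppr_eq0; case: (eqVneq k 0) => [//|k0].
have [x0 x1 ->] := multiplier_opp k0.
have x2 : q ^ (n%:Z * k) - 1 != 0 by rewrite -opprB oppr_eq0.
by field; rewrite x0 x1 x2.
Qed.

Lemma gd_adjoint_a : adjoint gd_a (\- gd_a).
Proof.
move=> f g; rewrite -[(\- gd_a) g]/(- gd_a g) (gd_aE f) (gd_aE g).
have -> : - diag multiplier_a g = diag (fun k => - multiplier_a k) g.
  by apply/lserP => k; rewrite lcoefN !coef_diag mulNr.
by apply: diag_adjoint => k; rewrite multiplier_aN.
Qed.

Lemma gd_adjoint_d : adjoint gd_d (\- gd_d).
Proof.
have dE f : gd_d f = - gd_a f by [].
move=> f g; rewrite -[(\- gd_d) g]/(- gd_d g) !dE lmulNl residueN gd_adjoint_a.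
by rewrite -[(\- gd_a) g]/(- gd_a g) [in RHS]lmulNr residueN.
Qed.

Lemma gd_adjoint_c : adjoint gd_c gd_b.
Proof.
move=> f g; rewrite gd_cE gd_bE; apply: diag_adjoint => k.
by rewrite -multiplier_bN opprK.
Qed.

Lemma gd_sum_ab f : gd_a f + gd_b f - 2^-1 *: f = 0.
Proof.
apply/lserP => k; rewrite gd_aE gd_bE lcoefB lcoefD laurentZ !coef_diag lcoef0.
rewrite /multiplier_a /multiplier_b; case: (eqVneq k 0) => [_|k0]; first by ring.
by have x1 := one_minus_q k0; field.
Qed.

Lemma gd_sum_cd f : gd_c f + gd_d f - 2^-1 *: f = 0.
Proof.
apply/lserP => k; rewrite gd_cE gd_dE lcoefB lcoefD laurentZ !coef_diag lcoef0.
rewrite /multiplier_d /multiplier_a /multiplier_c.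
case: (eqVneq k 0) => [_|k0]; first by ring.
by have x1 := one_minus_q k0; field.
Qed.

Lemma gd_top_defect f g : residue f = residue g ->
  top_defect q gd_a gd_b gd_c gd_d n f g = 0.
Proof.
move=> fg; rewrite -[top_defect _ _ _ _ _ _ _ _]/((gd_a f + gd_b g - 2^-1 *: f)
  - hpow q n%:Z (gd_c f + gd_d g - 2^-1 *: g)).
apply/lserP => k; rewrite gd_aE gd_bE gd_cE gd_dE.
rewrite lcoefB coef_hpow !lcoefB !lcoefD !laurentZ !coef_diag lcoef0.
rewrite /multiplier_d /multiplier_a /multiplier_b /multiplier_c.
case: (eqVneq k 0) => [->|k0].
  by rewrite mulr0 expr0z -[f 0]/(residue f) -[g 0]/(residue g) fg; field.
by have x1 := one_minus_q k0; field.
Qed.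

Local Notation brk := (bracket_at q gd_a gd_b gd_c gd_d).
Local Notation ham := (hamfield q gd_a gd_b gd_c gd_d).

Lemma gd_tangent L U : Mn n L -> tangent n (ham L U).
Proof. by move=> LM; apply: hamfield_tangent => //; exact: gd_top_defect. Qed.

Lemma gd_lax L U W : pmul L U = W -> pmul U L = W ->
  ham L U = commutator q (Pnonneg W) L.
Proof.
move=> LU UL; rewrite (hamfield_lax q0 _ _ _ _ LU UL) gd_sum_ab gd_sum_cd.
have -> : inJ0 0 = 0 :> PsiD.
  by apply/lserP => i; rewrite coef_mono if_same.
by rewrite pmul0l pmul0r subr0 addr0.
Qed.

(** Gradients along M_n are only determined up to elements that annihilate the
    tangent directions; these do not matter because fields are tangent. *)
Lemma gd_gradient_indep (H : functional R) L U U' V : Mn n L ->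
  is_gradient q (Mn n) H L U -> is_gradient q (Mn n) H L U' ->
  brk L U V = brk L U' V.
Proof.
move=> LM HU HU'.
rewrite !(bracket_atl q0 gd_adjoint_a gd_adjoint_d gd_adjoint_c); congr (- _).
rewrite [LHS](pairingC q0) [RHS](pairingC q0).
apply: (is_gradient_unique HU HU'); apply/(Mn_line _ LM); exact: gd_tangent.
Qed.

Lemma gd_lax_hamiltonians : lax_hamiltonians q gd_a gd_b gd_c gd_d n.
Proof.
have gradient := hamiltonian_gradient q0 q_nonroot n0.
split.
- by move=> m L m0 LM; have [U [HU _ _]] := gradient _ _ m0 LM; exists U.
- move=> m m' m0 m'0 L U U' LM HU HU'.
  have [V [HV LV VL]] := gradient _ _ m0 LM.
  have [V' [HV' LV' V'L]] := gradient _ _ m'0 LM.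
  rewrite (gd_gradient_indep _ LM HU HV).
  rewrite (bracket_atC q0 gd_adjoint_a gd_adjoint_d gd_adjoint_c).
  rewrite (gd_gradient_indep _ LM HU' HV').
  rewrite -(bracket_atC q0 gd_adjoint_a gd_adjoint_d gd_adjoint_c).
  rewrite (hamfieldE q0) (gd_lax LV VL) /commutator pairingBl.
  by rewrite pairingMl// LV' pairingMr// V'L subrr.
- move=> m m0 L U psi LM HU _.
  have [V [HV LV VL]] := gradient _ _ m0 LM.
  by rewrite (gd_gradient_indep _ LM HU HV) (hamfieldE q0) (gd_lax LV VL) pairingC.
Qed.

Lemma gd_exists : gelfand_dickey_bracket q n (bracket q gd_a gd_b gd_c gd_d).
Proof.
exists gd_a, gd_b, gd_c, gd_d; split=> //.
- by split; [exact: gd_adjoint_a|exact: gd_adjoint_d|exact: gd_adjoint_c].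
- by apply: poisson_bracket_Rmatrix => //;
    [exact: gd_adjoint_a|exact: gd_adjoint_d|exact: gd_adjoint_c].
- by apply: poisson_submanifold_Mn => //;
    [exact: gd_adjoint_a|exact: gd_adjoint_d|exact: gd_adjoint_c|exact: gd_top_defect].
- exact: gd_lax_hamiltonians.
Qed.

End Existence.

(** * Uniqueness *)

Section Uniqueness.
Context {R : realType} (q : R[i]) (q0 : q != 0).
Hypothesis q_nonroot : forall k : int, k != 0 -> q ^ k != 1.
Local Notation C := R[i].
Local Notation PsiD := (PsiD R).
Local Notation pmul := (pmul q).
Local Notation pairing := (pairing q).
Context (n : nat) (n0 : (0 < n)%N).
Implicit Types (L P U V W X Y Z : PsiD) (f g w u : laurent R).

(** What tangency to M_n and the Lax equation of Tr L say about the operators. *)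
Definition rigid (a b c d : laurent R -> laurent R) : Prop :=
  [/\ adjoint a (\- a) /\ adjoint d (\- d), adjoint c b,
      forall w, residue w = 0 ->
        a w = 2^-1 *: w + hpow q n%:Z (c w) /\
        b w = hpow q n%:Z (d w) - 2^-1 *: hpow q n%:Z w &
      forall j : int, exists k : C,
        a (zpow j) + b (zpow j) - 2^-1 *: zpow j = k *: zpow 0 /\
        c (zpow j) + d (zpow j) - 2^-1 *: zpow j = k *: zpow 0].

Lemma Mn_binomial u : Mn n (mono n%:Z (zpow 0) + inJ0 u).
Proof.
split=> [|i ni|i i0]; rewrite lcoefD !coef_mono.
- by rewrite eqxx ifF ?addr0//; apply/eqP; lia.
- by rewrite !ifF ?addr0//; apply/eqP; lia.
- by rewrite !ifF ?addr0//; apply/eqP; lia.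
Qed.

Lemma binomial0 u : (mono n%:Z (zpow 0) + inJ0 u : PsiD) 0 = u.
Proof. by rewrite lcoefD !coef_mono eqxx ifF ?add0r//; apply/eqP; lia. Qed.

Section Constraints.
Variables a b c d : {linear laurent R -> laurent R}.
Hypotheses (ha : adjoint a (\- a)) (hd : adjoint d (\- d)) (hc : adjoint c b).
Local Notation defect := (top_defect q a b c d n).

Lemma top_defectD f f' g g' : defect (f + f') (g + g') = defect f g + defect f' g'.
Proof.
rewrite /top_defect !linearD/=.
move: (2^-1 *: f) (2^-1 *: f') => ? ?.
by apply/lserP => k; rewrite !(lcoefD, lcoefN, laurentZ, coef_hpow); ring.
Qed.

(** For L = D^n + 1, the choices V = v and V = v D^-n give the pairs (v, v) and
    (h^n v, v) of constant parts.  They span all pairs of equal residue, because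
    h^n - 1 is onto the series without constant term. *)
Lemma submanifold_top_defect w :
  poisson_submanifold q (bracket q a b c d) (Mn n) -> residue w = 0 ->
  defect w 0 = 0 /\ defect 0 w = 0.
Proof.
move=> PS w0; pose L : PsiD := mono n%:Z (zpow 0) + inJ0 (zpow 0).
have LM : Mn n L by exact: Mn_binomial.
have diagonal v : defect v v = 0.
  have := top_defect_Mn q0 ha hd hc (inJ0 v) LM PS.
  by rewrite /P0 pmul_inJ0l pmul_inJ0r binomial0 lmul1l lmul1r hpow0.
have shifted v : defect (hpow q n%:Z v) v = 0.
  have := top_defect_Mn q0 ha hd hc (mono (- n%:Z) v) LM PS.
  rewrite /P0 pmul_monol pmul_monor sub0r opprK.
  by have [-> _ _] := LM; rewrite lmul1l hpow_zpow0 lmul1r.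
pose v := diag (fun k => (q ^ (n%:Z * k) - 1)^-1) w.
have wE : w = hpow q n%:Z v - v.
  apply/lserP => k; rewrite lcoefB coef_hpow coef_diag.
  case: (eqVneq k 0) => [->|k0].
    by rewrite -[w 0]/(residue w) w0 !mulr0 subrr.
  rewrite -[X in _ - X]mul1r -mulrBl mulVKf//.
  by rewrite subr_eq0 q_nonroot// mulf_neq0// -lt0n.
have w1 : defect w 0 = 0.
  have := shifted v.
  have -> : hpow q n%:Z v = w + v by rewrite wE subrK.
  by rewrite -[X in defect _ X]add0r top_defectD diagonal addr0.
split=> //; have := diagonal w.
by rewrite -[X in defect X _]addr0 -[X in defect _ X]add0r top_defectD w1 add0r.
Qed.

(** Here H_n = Tr L, with gradient 1, and the Lax field vanishes because [L] is
    its own differential part; the terms in J_0 of [hamfield_lax] remain. *)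
Lemma lax_binomial u :
  lax_hamiltonians q a b c d n ->
  let L : PsiD := mono n%:Z (zpow 0) + inJ0 u in
  pmul (inJ0 (a u + b u - 2^-1 *: u)) L = pmul L (inJ0 (c u + d u - 2^-1 *: u)).
Proof.
move=> [_ _ gen] L; have LM : Mn n L by exact: Mn_binomial.
have fracE M : Mn n M -> fracpow q n n M = M.
  by move=> /(rootP q0 q_nonroot n0)[].
have nn : n%:R / n%:R = 1 :> C by rewrite divff// pnatr_eq0 -lt0n.
have grad1 : is_gradient q (Mn n) (hamiltonian q n n) L pid.
  apply: pcurve_gradient => X LX.
  apply: pcurve_eq (pcurve_lin (Tr_linear (R := R)) (pcurve_line L X)) _ _.
    by move=> t; rewrite /hamiltonian nn mul1r fracE.
  by rewrite /pairing pmul1l.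
have L_diff : Pnonneg L = L.
  apply/lserP => i; rewrite coef_trunc; case: leP => // i0.
  by case: LM => _ _ ->.
have comm0 : commutator q (Pnonneg (fracpow q n n L)) L = 0.
  by rewrite fracE// L_diff /commutator subrr.
have := hamfield_lax q0 a b c d (pmul1r q L) (pmul1l q L).
rewrite -[in X in commutator q (Pnonneg X)](fracE L LM) comm0 add0r.
have L0 : P0 L = u by exact: binomial0.
rewrite L0 => hamE; apply/eqP; rewrite -subr_eq0 -hamE; apply/eqP.
apply: (pairing_nondegenerate q0) => V.
have := gen n n0 L pid (pairing V) LM grad1 (smooth_linear q V).
rewrite (grad_linear q0) comm0 pairing0r => e.
by rewrite -(hamfieldE q0) -e (pairingC q0) pairing0r.
Qed.

Lemma gd_rigid :
  poisson_submanifold q (bracket q a b c d) (Mn n) ->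
  lax_hamiltonians q a b c d n -> rigid a b c d.
Proof.
move=> PS lax; split=> // [w w0|j].
  have [] := submanifold_top_defect PS w0; rewrite /top_defect !linear0.
  move=> e1 e2; split; apply/lserP => k.
    have /eqP := congr1 (fun f : laurent R => f k) e1.
    rewrite !(lcoefD, lcoefN, laurentZ, coef_hpow, lcoef0) => /eqP e.
    by apply/eqP; rewrite -subr_eq0 -e; apply/eqP; ring.
  have /eqP := congr1 (fun f : laurent R => f k) e2.
  rewrite !(lcoefD, lcoefN, laurentZ, coef_hpow, lcoef0) => /eqP e.
  by apply/eqP; rewrite -subr_eq0 -e; apply/eqP; ring.
have := lax_binomial (zpow j) lax; rewrite /=.
move: (a _ + _ - _) (c _ + _ - _) => s t e.
pose L : PsiD := mono n%:Z (zpow 0) + inJ0 (zpow j).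
have e0 : pmul (inJ0 s) L 0 = pmul L (inJ0 t) 0 by rewrite e.
have en : pmul (inJ0 s) L n%:Z = pmul L (inJ0 t) n%:Z by rewrite e.
rewrite pmul_inJ0l pmul_inJ0r binomial0 hpow0 in e0.
have [Ln _ _] := Mn_binomial (zpow j).
rewrite pmul_inJ0l pmul_inJ0r Ln lmul1r lmul1l in en.
have zz : lmul (zpow j) (zpow (- j)) = zpow 0 :> laurent R.
  apply/lserP => k; rewrite lmul_monol mul1r !coef_mono.
  by have -> : (k - j == - j) = (k == 0) by apply/eqP/eqP; lia.
have st : s = t.
  have := congr1 (fun f => lmul f (zpow (- j))) e0.
  by rewrite -lmulA zz lmul1r (lmulC _ t) -lmulA zz lmul1r.
have tE : t = t 0 *: zpow 0.
  apply/lserP => k; rewrite laurentZ coef_mono.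
  case: (eqVneq k 0) => [->|k0]; first by rewrite mulr1.
  have := congr1 (fun f : laurent R => f k) en.
  rewrite st coef_hpow => /eqP; rewrite -subr_eq0 -{1}[t k]mul1r -mulrBl.
  rewrite mulf_eq0 subr_eq0 eq_sym => /orP[|/eqP ->]; last by rewrite mulr0.
  by rewrite (negPf (q_nonroot _))// mulf_neq0// -lt0n.
by exists (t 0); rewrite st -tE.
Qed.

End Constraints.

(** The four operators themselves are not determined by [rigid]: what two
    solutions have in common is the value of the form on pairs of left and
    right gradients, which have the same trace. *)
Lemma rigid_const (a b c d a' b' c' d' : laurent R -> laurent R) f g :
  rigid a b c d -> rigid a' b' c' d' -> residue f = residue g ->
  exists k : C, a f + b g = a' f + b' g + k *: zpow 0 /\
                c f + d g = c' f + d' g + k *: zpow 0.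
Proof.
move=> [[Aa Ad] Ac Aw Az] [[Aa' Ad'] Ac' Aw' Az'] fg.
pose al u := a u - a' u; pose be u := b u - b' u.
pose ga u := c u - c' u; pose de u := d u - d' u.
have skew (e : laurent R -> laurent R) u v : adjoint e (\- e) ->
    residue (lmul (e u) v) = - residue (lmul u (e v)).
  by move=> ee; rewrite -residueN -lmulNr; exact: ee.
have ala u v : residue (lmul (al u) v) = - residue (lmul u (al v)).
  by rewrite lmulBl lmulBr !residueD !residueN (skew a)// (skew a')//; ring.
have dea u v : residue (lmul (de u) v) = - residue (lmul u (de v)).
  by rewrite lmulBl lmulBr !residueD !residueN (skew d)// (skew d')//; ring.
have gaa u v : residue (lmul (ga u) v) = residue (lmul u (be v)).
  by rewrite lmulBl lmulBr !residueD !residueN Ac Ac'.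
have bea u v : residue (lmul (be u) v) = residue (lmul u (ga v)).
  by rewrite lmulC -gaa lmulC.
have alw w k : residue w = 0 -> al w k = q ^ (n%:Z * k) * ga w k.
  move=> w0; have [e _] := Aw w w0; have [e' _] := Aw' w w0.
  by rewrite /al e e' /ga; rewrite !(lcoefD, lcoefN, laurentZ, coef_hpow); ring.
have bew w k : residue w = 0 -> be w k = q ^ (n%:Z * k) * de w k.
  move=> w0; have [_ e] := Aw w w0; have [_ e'] := Aw' w w0.
  by rewrite /be e e' /de; rewrite !(lcoefD, lcoefN, laurentZ, coef_hpow); ring.
have sums j : exists l : C, al (zpow j) + be (zpow j) = l *: zpow 0 /\
    ga (zpow j) + de (zpow j) = l *: zpow 0.
  have [l [e1 e2]] := Az j; have [l' [e1' e2']] := Az' j.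
  exists (l - l'); rewrite scalerBl -{1}e1 -{1}e1' -e2 -e2'.
  by split; apply/lserP => k; rewrite !(lcoefD, lcoefN, laurentZ); ring.
have entry (T : laurent R -> laurent R) u k :
  T u k = residue (lmul (T u) (zpow (- k))) by rewrite residue_zpow.
have zres j : j != 0 -> residue (zpow j : laurent R) = 0.
  by move=> j0; rewrite /residue coef_mono eq_sym (negPf j0).
have gde j k : k != 0 -> de (zpow j) k = - ga (zpow j) k.
  move=> k0; have [l [_ /(congr1 (fun f : laurent R => f k))]] := sums j.
  rewrite lcoefD laurentZ coef_mono (negPf k0) mulr0 addrC.
  by move/eqP; rewrite addr_eq0 => /eqP.
(* Both the (k, j) entry of ga and that of al equal - q^(-nj) times the
   (-j, -k) entry of ga, while al is q^(nk) ga in these entries. *)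
have ga0 j k : j != 0 -> k != 0 -> ga (zpow j) k = 0.
  move=> j0 k0; have kN : - k != 0 by rewrite oppr_eq0.
  have jN : - j != 0 by rewrite oppr_eq0.
  have sw (u : laurent R) : residue (lmul (zpow j) u) = u (- j).
    by rewrite lmulC -[in LHS](opprK j) residue_zpow.
  have e1 : ga (zpow j) k = - (q ^ (n%:Z * - j) * ga (zpow (- k)) (- j)).
    by rewrite entry gaa sw bew ?zres// gde// mulrN.
  have e2 : al (zpow j) k = - (q ^ (n%:Z * - j) * ga (zpow (- k)) (- j)).
    by rewrite entry ala sw alw ?zres.
  move: e2; rewrite -e1 alw ?zres// => /eqP.
  rewrite -subr_eq0 -[X in _ - X]mul1r -mulrBl mulf_eq0 subr_eq0.
  by rewrite (negPf (q_nonroot _)) /= => [/eqP//|]; rewrite mulf_neq0// -lt0n.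
have al0 j k : j != 0 -> k != 0 -> al (zpow j) k = 0.
  by move=> j0 k0; rewrite alw ?zres// ga0// mulr0.
have de0 j k : j != 0 -> k != 0 -> de (zpow j) k = 0.
  by move=> j0 k0; rewrite gde// ga0// oppr0.
have be0 j k : j != 0 -> k != 0 -> be (zpow j) k = 0.
  by move=> j0 k0; rewrite bew ?zres// de0// mulr0.
have alga j : j != 0 -> al (zpow j) 0 = ga (zpow j) 0.
  by move=> j0; rewrite alw ?zres// mulr0 expr0z mul1r.
have bede j : j != 0 -> be (zpow j) 0 = de (zpow j) 0.
  by move=> j0; rewrite bew ?zres// mulr0 expr0z mul1r.
have const (T : laurent R -> laurent R) j u : (forall k, k != 0 -> T (zpow j) k = 0) ->
    residue (lmul u (T (zpow j))) = T (zpow j) 0 * residue u.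
  move=> T0; set t := T (zpow j) 0.
  have -> : T (zpow j) = t *: zpow 0.
    apply/lserP => k; rewrite laurentZ coef_mono.
    by case: (eqVneq k 0) => [->|k0]; rewrite ?mulr1// mulr0 T0.
  by rewrite lmulZr lmul1r residueZ.
have E1 k : k != 0 -> (al f + be g) k = 0.
  move=> k0; have kN : - k != 0 by rewrite oppr_eq0.
  rewrite lcoefD (entry al) (entry be) ala bea !const; [|by move=> *; exact: ga0|by move=> *; exact: al0].
  by rewrite alga// fg addNr.
have E2 k : k != 0 -> (ga f + de g) k = 0.
  move=> k0; have kN : - k != 0 by rewrite oppr_eq0.
  rewrite lcoefD (entry ga) (entry de) gaa dea !const; [|by move=> *; exact: de0|by move=> *; exact: be0].
  by rewrite bede// fg subrr.
have E0 : (al f + be g) 0 = (ga f + de g) 0.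
  have [l [e1 e2]] := sums 0.
  rewrite (lcoefD (al f)) (lcoefD (ga f)) (entry al) (entry be) (entry ga) (entry de) ala bea gaa dea oppr0.
  have beE : be (zpow 0) = l *: zpow 0 - al (zpow 0) by rewrite -e1 addrC addKr.
  have deE : de (zpow 0) = l *: zpow 0 - ga (zpow 0) by rewrite -e2 addrC addKr.
  move: beE deE.
  move: (al (zpow 0)) (be (zpow 0)) (ga (zpow 0)) (de (zpow 0)) => A B G D -> ->.
  rewrite !lmulBr !lmulZr !lmul1r !residueD !residueN !residueZ fg.
  by ring.
exists ((al f + be g) 0).
have const0 u : (forall k, k != 0 -> u k = 0) -> u = u 0 *: zpow 0.
  move=> u0; apply/lserP => k; rewrite laurentZ coef_mono.
  by case: (eqVneq k 0) => [->|k0]; rewrite ?mulr1// mulr0 u0.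
split; [|rewrite E0]; rewrite -const0//; apply/lserP => k;
  rewrite !(lcoefD, lcoefN); ring.
Qed.

Lemma rigid_bracket (a b c d a' b' c' d' : {linear laurent R -> laurent R}) :
  rigid a b c d -> rigid a' b' c' d' ->
  bracket q a b c d = bracket q a' b' c' d'.
Proof.
move=> r r'; apply/funext => phi; apply/funext => psi; apply/funext => L.
rewrite /bracket /bracket_at /pairing2 !Rmatrix1E !Rmatrix2E /=.
move: (grad q phi L) (grad q psi L) => U V.
have fg : residue (P0 (pmul L U)) = residue (P0 (pmul U L)) by exact: TrC.
have [k [-> ->]] := rigid_const r r' fg.
rewrite !inJ0D !pairingDl !pairing_inJ0 !lmulZl !lmul1l !residueZ.
have -> : residue (P0 (pmul L V)) = residue (P0 (pmul V L)) by exact: TrC.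
by ring.
Qed.

End Uniqueness.

Theorem theorem2p7 (R : realType) (q : R[i]) (hq0 : 0 < `|q|) (hq1 : `|q| < 1)
    (n : nat) (hn : (0 < n)%N) :
  (exists! br : functional R -> functional R -> functional R,
      gelfand_dickey_bracket q n br) /\
  (forall br : functional R -> functional R -> functional R,
      gelfand_dickey_bracket q n br ->
      br = bracket q
        (fun f => 2^-1 *: ratP0' q n (fun x => (1 + x) / (1 - x)) f)
        (fun f => - ratP0' q n (fun x => x / (1 - x)) f + 2^-1 *: P00 f)
        (fun f => ratP0' q n (fun x => (1 - x)^-1) f + 2^-1 *: P00 f)
        (fun f => - (2^-1 *: ratP0' q n (fun x => (1 + x) / (1 - x)) f))).
Proof.
have q0 : q != 0 by rewrite -normr_gt0.
have q_nat (m : nat) : (0 < m)%N -> q ^+ m != 1.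
  move=> m0; apply/eqP => /(congr1 Num.norm); rewrite normrX normr1 => e.
  by have := exprn_ilt1 m (normr_ge0 q) hq1; rewrite e ltxx -lt0n m0.
have q_nonroot (k : int) : k != 0 -> q ^ k != 1.
  case: k => [m|m] k0; first by apply: q_nat; rewrite lt0n.
  by rewrite NegzE -exprnN -invr1 (inj_eq invr_inj) q_nat.
have ex := gd_exists q0 q_nonroot hn.
have uniq br : gelfand_dickey_bracket q n br ->
    br = bracket q (gd_a q n) (gd_b q n) (gd_c q n) (gd_d q n).
  move=> [a [b [c [d [[ha hd hc] -> _ PS lax]]]]].
  have [a' [b' [c' [d' [[ha' hd' hc'] -> _ PS' lax']]]]] := ex.
  by apply: (rigid_bracket q0 q_nonroot hn);
    [exact: gd_rigid PS lax|exact: gd_rigid PS' lax'].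
split; last by move=> br /uniq.
by exists (bracket q (gd_a q n) (gd_b q n) (gd_c q n) (gd_d q n)); split=> // br /uniq.
Qed.
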